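(* Let $\mathbf U_h^n$ be a piecewise polynomial DG function of degree at most $k$ on cells $I_i=[x_{i-1/2},x_{i+1/2}]$ of length $h$, with one-sided limits $\mathbf U_{i+1/2}^\pm$ at $x_{i+1/2}$, let $\lambda=\Delta t/h$, and let $$\bar{\mathbf U}_i^{n+1}=\bar{\mathbf U}_i^n-\lambda(\hat{\mathbf F}_{i+\frac12}-\hat{\mathbf F}_{i-\frac12})-\lambda(\mathcal D_{i+\frac12}^-+\mathcal D_{i-\frac12}^+)-\lambda\int_{I_i}\mathbf S(\mathbf U_h^n)\frac{\partial B_{x,h}^n}{\partial x}\,\mathrm dx .$$ Let $\hat x_1<\dots<\hat x_N$ be the $N$ Gauss--Lobatto points on $I_i$, $N\ge k+1$, with weights $\omega_1+\dots+\omega_N=1$, $\mathbf U_q=\mathbf U_h^n|_{I_i}(\hat x_q)$, and $\tilde{\mathcal U}_i^n=\sum_{q=1}^N\omega_q\,\mathcal U(\mathbf U_q)$. Let $\Phi_i(\xi)=\mathbf U_h^n|_{I_i}(x_{i-1/2}+\xi(x_{i+1/2}-x_{i-1/2}))$, $\xi\in[0,1]$. Then the weak cell entropy inequality $$\mathcal U(\bar{\mathbf U}_i^{n+1})\le\tilde{\mathcal U}_i^n-\lambda(\hat{\mathcal F}_{i+\frac12}-\hat{\mathcal F}_{i-\frac12})\qquad(\ast)$$ holds in each of the following cases. (1) If $\mathbf U_{i-1/2}^+\ne\mathbf U_{i+1/2}^-$, then $(\ast)$ holds under $$\lambda\le\omega_1\mathscr T(\mathbf U_{i-\frac12}^-,\mathbf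 U_{i-\frac12}^+,\mathbf U_{i+\frac12}^-;\Psi_{i-\frac12},\Phi_i),\qquad\lambda\le\omega_N\mathscr T(\mathbf U_{i-\frac12}^+,\mathbf U_{i+\frac12}^-,\mathbf U_{i+\frac12}^+;\Phi_i,\Psi_{i+\frac12}).$$ (2) Suppose $\mathbf U_{i-1/2}^+=\mathbf U_{i+1/2}^-=:\mathbf U_f$. (2a) If there is $s\in\{2,\dots,N-1\}$ with $\mathbf U_s\ne\mathbf U_f$, then $(\ast)$ holds under $$\lambda\le\omega_1\mathscr T(\mathbf U_{i-\frac12}^-,\mathbf U_{i-\frac12}^+,\mathbf U_s;\Psi_{i-\frac12},\Phi_i^L),\quad\lambda\le\omega_s\mathscr T(\mathbf U_{i-\frac12}^+,\mathbf U_s,\mathbf U_{i+\frac12}^-;\Phi_i^L,\Phi_i^R),\quad\lambda\le\omega_N\mathscr T(\mathbf U_s,\mathbf U_{i+\frac12}^-,\mathbf U_{i+\frac12}^+;\Phi_i^R,\Psi_{i+\frac12}),$$ where $\Phi_i^L$ and $\Phi_i^R$ are the portions of $\Phi_i$ from $\mathbf U_{i-1/2}^+$ to $\mathbf U_s$ (i.e. over $[x_{i-1/2},\hat x_s]$) and from $\mathbf U_s$ to $\mathbf U_{i+1/2}^-$ (i.e. over $[\hat x_s,x_{i+1/2}]$), reparametrized over $[0,1]$. (2b) If no such $s$ exists, then $\mathbf U_h^n|_{I_i}\equiv\mathbf U_f$, and $(\ast)$ holds under $$\lambda\le\mathscr T(\mathbf U_{i-\frac12}^-,\mathbf U_f,\mathbf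 U_{i+\frac12}^+;\Psi_{i-\frac12},\Psi_{i+\frac12});$$ if one of the two exterior states $\mathbf U_{i-1/2}^-,\mathbf U_{i+1/2}^+$ coincides with $\mathbf U_f$, the corresponding entropy-stability wave-speed condition is omitted; if both coincide with $\mathbf U_f$, no CFL restriction is required.
   Context: **MHD system (flow varying in $x$ only).** The state is $\mathbf U=(\rho,\rho\mathbf u,\mathcal E,\mathbf B)\in\mathbb R^p$ with $\mathbf u,\mathbf B\in\mathbb R^m$ ($m\in\{1,2,3\}$, $p=2m+2$); $u_x,B_x$ are the first components of $\mathbf u,\mathbf B$. With $\gamma=5/3$, the pressure $P$ is defined by $\mathcal E=\frac{P}{\gamma-1}+\frac12\rho\|\mathbf u\|^2+\frac12\|\mathbf B\|^2$, and $P^\star=P+\frac12\|\mathbf B\|^2$. The admissible set is $G=\{\mathbf U:\rho>0,\ P>0\}$ (convex); all states, the DG function and all paths take values in $G$. The $x$-flux is $\mathbf F(\mathbf U)=(\rho u_x,\ \rho u_x\mathbf u+P^\star\mathbf e_1-B_x\mathbf B,\ u_x(\mathcal E+P^\star)-B_x(\mathbf u\cdot\mathbf B),\ u_x\mathbf B-B_x\mathbf u)$. Entropy and entropy flux: $\mathcal U=-\frac{\rho s}{\gamma-1}$, $\mathcal F=-\frac{\rho su_x}{\gamma-1}$, $s=\ln(P\rho^{-\gamma})$; $\mathcal U$ is strictly convex on $G$ with positive definite Hessian. $\mathcal U'$ is the gradient as a row vector, $\mathbf V=\mathcal U'(\mathbf U)^T$. With $\beta=\rho/(2P)$, $\phi(\mathbf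 V)=2\beta(\mathbf u\cdot\mathbf B)$, set $\mathbf S(\mathbf U)=\phi'(\mathbf V)^T=(0,\mathbf B,\mathbf u\cdot\mathbf B,\mathbf u)^T$. $B_x'=\partial B_x/\partial\mathbf U$ is a constant row vector ($1$ in the $B_x$ position, $0$ elsewhere). One has $\mathcal F'=\mathcal U'\mathbf F'+\phi(\mathbf V)B_x'$ and $\mathcal U'\mathbf S=\phi$. The system discretized is $\partial_t\mathbf U+\partial_x\mathbf F(\mathbf U)=-\mathbf S(\mathbf U)\partial_xB_x$. **Paths.** A prescribed path is a Lipschitz function $\Psi(\xi;\mathbf U^-,\mathbf U^+)$, $\xi\in[0,1]$, with $\Psi(0;\mathbf U^-,\mathbf U^+)=\mathbf U^-$, $\Psi(1;\mathbf U^-,\mathbf U^+)=\mathbf U^+$, $\Psi(\xi;\mathbf U,\mathbf U)=\mathbf U$. A generalized path from $\mathbf a$ to $\mathbf b$ is a Lipschitz $\Phi:[0,1]\to G$ with $\Phi(0)=\mathbf a,\Phi(1)=\mathbf b$. Write $J(\Phi)=\int_0^1\mathbf S(\Phi(\xi))B_x'\Phi'(\xi)\,\mathrm d\xi$. **Wave speeds.** For $\mathbf a,\mathbf b\in G$ and a generalized path $\Phi$ from $\mathbf a$ to $\mathbf b$: $\mathcal S_R^{\rm std}=\max\{\sigma_{\max}(\mathbf F'(\mathbf a)),\sigma_{\max}(\mathbf F'(\mathbf b)),0\}$, $\mathcal S_L^{\rm std}=\min\{\sigma_{\min}(\mathbf F'(\mathbf a)),\sigma_{\min}(\mathbf F'(\mathbf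 b)),0\}$ ($\sigma_{\max},\sigma_{\min}$: largest, smallest eigenvalue). If $\mathbf a\neq\mathbf b$, with $\mathbf d=\mathbf b-\mathbf a$ and $\mathbf e=\mathbf a-\mathbf b$, $$\mathcal S_R^{\rm ES}=\frac{\int_0^1\!\int_0^\xi\mathbf d^T\mathcal U''(\mathbf a+\zeta\mathbf d)\mathbf F'(\mathbf a+\xi\mathbf d)\mathbf d\,\mathrm d\zeta\mathrm d\xi+\int_0^1\mathcal U'(\mathbf a+\xi\mathbf d)\mathbf S(\mathbf a+\xi\mathbf d)B_x'\mathbf d\,\mathrm d\xi-\mathcal U'(\mathbf a)J(\Phi)}{\int_0^1\!\int_0^\xi\mathbf d^T\mathcal U''(\mathbf a+\zeta\mathbf d)\mathbf d\,\mathrm d\zeta\mathrm d\xi},$$ $$\mathcal S_L^{\rm ES}=\frac{\int_0^1\!\int_0^\xi\mathbf e^T\mathcal U''(\mathbf b+\zeta\mathbf e)\mathbf F'(\mathbf b+\xi\mathbf e)\mathbf e\,\mathrm d\zeta\mathrm d\xi+\int_0^1\mathcal U'(\mathbf b+\xi\mathbf e)\mathbf S(\mathbf b+\xi\mathbf e)B_x'\mathbf e\,\mathrm d\xi+\mathcal U'(\mathbf b)J(\Phi)}{\int_0^1\!\int_0^\xi\mathbf e^T\mathcal U''(\mathbf b+\zeta\mathbf e)\mathbf e\,\mathrm d\zeta\mathrm d\xi}.$$ The wave speeds of $(\mathbf a,\mathbf b;\Phi)$ are $\mathcal S_R=\max\{\mathcal S_R^{\rm std},\mathcal S_R^{\rm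 ES}\}$, $\mathcal S_L=\min\{\mathcal S_L^{\rm std},\mathcal S_L^{\rm ES}\}$; if $\mathbf a=\mathbf b$ the ES conditions are omitted (std values are used). It is understood that $\mathcal S_R>\mathcal S_L$. **Fluxes.** For $(\mathbf a,\mathbf b;\Phi)$ with these wave speeds: $\hat{\mathbf F}=\frac{\mathcal S_R\mathbf F(\mathbf a)-\mathcal S_L\mathbf F(\mathbf b)+\mathcal S_R\mathcal S_L(\mathbf b-\mathbf a)}{\mathcal S_R-\mathcal S_L}$, $\hat{\mathcal F}=\frac{\mathcal S_R\mathcal F(\mathbf a)-\mathcal S_L\mathcal F(\mathbf b)+\mathcal S_R\mathcal S_L(\mathcal U(\mathbf b)-\mathcal U(\mathbf a))}{\mathcal S_R-\mathcal S_L}$, $\mathcal R^+=\frac{\mathcal S_R}{\mathcal S_R-\mathcal S_L}$, $\mathcal R^-=\frac{-\mathcal S_L}{\mathcal S_R-\mathcal S_L}$, $\mathcal A^\pm=\mathcal R^\pm J(\Phi)$. **DG interface quantities.** $\Psi_{i+\frac12}(\xi)=\Psi(\xi;\mathbf U^-_{i+\frac12},\mathbf U^+_{i+\frac12})$; $\hat{\mathbf F}_{i+\frac12},\hat{\mathcal F}_{i+\frac12}$ and $\mathcal D^\pm_{i+\frac12}=\mathcal R^\pm J(\Psi_{i+\frac12})$ are the quantities $\hat{\mathbf F},\hat{\mathcal F},\mathcal A^\pm$ for $(\mathbf U^-_{i+\frac12},\mathbf U^+_{i+\frac12};\Psi_{i+\frac12})$. $\bar{\mathbf U}^n_i$ is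 the cell average and $B^n_{x,h}$ the $B_x$-component of $\mathbf U_h^n$. The displayed update is the cell-average update of the forward Euler DG scheme. **Three-point scheme and the CFL quantity $\mathscr T$.** For $\mathbf a,\mathbf b,\mathbf c\in G$, generalized paths $\Phi_1$ from $\mathbf a$ to $\mathbf b$ and $\Phi_2$ from $\mathbf b$ to $\mathbf c$, $\mu\ge0$: $$\mathcal H(\mathbf a,\mathbf b,\mathbf c;\Phi_1,\Phi_2;\mu)=\mathbf b-\mu T_3,\quad T_3=\hat{\mathbf F}(\mathbf b,\mathbf c;\Phi_2)-\hat{\mathbf F}(\mathbf a,\mathbf b;\Phi_1)+\mathcal A^-(\mathbf b,\mathbf c;\Phi_2)+\mathcal A^+(\mathbf a,\mathbf b;\Phi_1).$$ Let $T_1=\hat{\mathcal F}(\mathbf b,\mathbf c;\Phi_2)-\mathcal F(\mathbf b)-\mathcal U'(\mathbf b)\big(\hat{\mathbf F}(\mathbf b,\mathbf c;\Phi_2)-\mathbf F(\mathbf b)+\mathcal A^-(\mathbf b,\mathbf c;\Phi_2)\big)$ and $T_2=\hat{\mathcal F}(\mathbf a,\mathbf b;\Phi_1)-\mathcal F(\mathbf b)-\mathcal U'(\mathbf b)\big(\hat{\mathbf F}(\mathbf a,\mathbf b;\Phi_1)-\mathbf F(\mathbf b)-\mathcal A^+(\mathbf a,\mathbf b;\Phi_1)\big)$. The condition $\mu\le\mathscr T(\mathbf a,\mathbf b,\mathbf c;\Phi_1,\Phi_2)$ means: $\mathbf b^{\rm new}=\mathcal H(\mathbf a,\mathbf b,\mathbf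 c;\Phi_1,\Phi_2;\mu)\in G$ and either $T_3=0$, or $\mu\le\frac{2(T_2-T_1)}{\|T_3\|^2}\big(\max_{\boldsymbol\eta}\sigma_{\max}(\mathcal U''(\boldsymbol\eta))\big)^{-1}$ with $\boldsymbol\eta$ ranging over the segment from $\mathbf b$ to $\mathbf b^{\rm new}$. ''$\lambda\le\omega\,\mathscr T(\cdots)$'' means this condition with $\mu=\lambda/\omega$. *)

(* Defs.v *)
From mathcomp Require Import all_boot all_order all_algebra.
From mathcomp Require Import all_classical all_reals all_analysis.

Set Implicit Arguments.
Unset Strict Implicit.
Unset Printing Implicit Defensive.

Import Order.TTheory GRing.Theory Num.Theory.
Import numFieldNormedType.Exports.

Local Open Scope classical_set_scope.
Local Open Scope ring_scope.

(* Vector-valued functions are integrated componentwise. *)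
Definition vintegral (R : realType) (n : nat) (a b : R) (f : R -> 'cV[R]_n) :
    'cV[R]_n :=
  \col_l (\int[lebesgue_measure]_(t in `[a, b]) (f t l 0)).

Definition grad (R : realType) (n : nat) (f : 'cV[R]_n -> R) (U : 'cV[R]_n) :
    'rV[R]_n :=
  \row_j 'D_(delta_mx j 0) f U.

Definition hess (R : realType) (n : nat) (f : 'cV[R]_n -> R) (U : 'cV[R]_n) :
    'M[R]_n :=
  \matrix_(i, j) 'D_(delta_mx i 0) (fun V => 'D_(delta_mx j 0) f V) U.

(* Row i holds the partial derivatives of the i-th component; the library's
   jacobian, for functions of row vectors, is the transpose of this. *)
Definition jac (R : realType) (n : nat) (f : 'cV[R]_n -> 'cV[R]_n)
    (U : 'cV[R]_n) : 'M[R]_n :=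
  \matrix_(i, j) 'D_(delta_mx j 0) (fun V => f V i 0) U.

Definition dotv (R : realType) (n : nat) (u v : 'cV[R]_n) : R :=
  \sum_j u j 0 * v j 0.

(* The set of eigenvalues is finite, so sup and inf are a maximum and a
   minimum as soon as it is nonempty. *)
Definition sigma_max (R : realType) (n : nat) (A : 'M[R]_n) : R :=
  sup [set s | eigenvalue A s].
Definition sigma_min (R : realType) (n : nat) (A : 'M[R]_n) : R :=
  inf [set s | eigenvalue A s].

(* A state is (rho, rho u, E, B), with u and B of dimension m.+1 so that they
   have a first component; the total dimension is 2 (m.+1) + 2. *)
Notation sdim m := (1 + (m.+1 + (1 + m.+1)))%N.
Notation state R m := ('cV[R]_(sdim m)).

Definition mkstate (R : realType) (m : nat) (r : R) (q : 'cV[R]_m.+1) (e : R)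
    (B : 'cV[R]_m.+1) : state R m :=
  col_mx (const_mx r) (col_mx q (col_mx (const_mx e) B)).

Definition iBx (m : nat) : 'I_(sdim m) :=
  rshift 1 (rshift m.+1 (rshift 1 (ord0 : 'I_m.+1))).

Definition rho (R : realType) (m : nat) (U : state R m) : R := usubmx U 0 0.
Definition mom (R : realType) (m : nat) (U : state R m) : 'cV[R]_m.+1 :=
  usubmx (dsubmx U).
Definition energy (R : realType) (m : nat) (U : state R m) : R :=
  usubmx (dsubmx (dsubmx U)) 0 0.
Definition mag (R : realType) (m : nat) (U : state R m) : 'cV[R]_m.+1 :=
  dsubmx (dsubmx (dsubmx U)).
Definition vel (R : realType) (m : nat) (U : state R m) : 'cV[R]_m.+1 :=
  (rho U)^-1 *: mom U.
Definition ux (R : realType) (m : nat) (U : state R m) : R := vel U ord0 0.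
Definition Bx (R : realType) (m : nat) (U : state R m) : R := U (iBx m) 0.

Definition gamma (R : realType) : R := 5 / 3.

Definition pressure (R : realType) (m : nat) (U : state R m) : R :=
  (gamma R - 1) * (energy U - 2^-1 * rho U * dotv (vel U) (vel U)
                   - 2^-1 * dotv (mag U) (mag U)).

Definition total_pressure (R : realType) (m : nat) (U : state R m) : R :=
  pressure U + 2^-1 * dotv (mag U) (mag U).

Definition admissible (R : realType) (m : nat) (U : state R m) : Prop :=
  0 < rho U /\ 0 < pressure U.

Definition flux (R : realType) (m : nat) (U : state R m) : state R m :=
  mkstate (rho U * ux U)
    ((rho U * ux U) *: vel U + total_pressure U *: delta_mx ord0 0
       - Bx U *: mag U)
    (ux U * (energy U + total_pressure U) - Bx U * dotv (vel U) (mag U))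
    (ux U *: mag U - Bx U *: vel U).

Definition spec_entropy (R : realType) (m : nat) (U : state R m) : R :=
  ln (pressure U * (rho U `^ (- gamma R))).
Definition entropy (R : realType) (m : nat) (U : state R m) : R :=
  - (rho U * spec_entropy U) / (gamma R - 1).
Definition entropy_flux (R : realType) (m : nat) (U : state R m) : R :=
  - (rho U * spec_entropy U * ux U) / (gamma R - 1).

(* The nonconservative source is - source U * dBx/dx; source is the gradient,
   in the entropy variables V, of phi(V) = (rho / P) (u . B). *)
Definition source (R : realType) (m : nat) (U : state R m) : state R m :=
  mkstate 0 (mag U) (dotv (vel U) (mag U)) (vel U).

Definition dBx (R : realType) (m : nat) : 'rV[R]_(sdim m) := delta_mx 0 (iBx m).

Definition generalized_path (R : realType) (m : nat) (a b : state R m)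
    (Phi : R -> state R m) : Prop :=
  [/\ [lipschitz Phi xi | xi in `[0, 1]],
      forall xi : R, 0 <= xi <= 1 -> admissible (Phi xi),
      Phi 0 = a & Phi 1 = b].

Definition prescribed_path (R : realType) (m : nat)
    (Psi : R -> state R m -> state R m -> state R m) : Prop :=
  (forall a b, admissible a -> admissible b ->
     generalized_path a b (fun xi => Psi xi a b)) /\
  (forall a (xi : R), admissible a -> 0 <= xi <= 1 -> Psi xi a a = a).

(* A Lipschitz Phi is differentiable almost everywhere on [0, 1]; derive1 takes
   a junk value on the remaining null set, and at the end points it depends on
   Phi outside [0, 1], neither of which affects the Lebesgue integral. *)
Definition path_integral (R : realType) (m : nat) (Phi : R -> state R m) :
    state R m :=
  vintegral 0 1
    (fun xi => source (Phi xi) *m dBx R m *m derive1 Phi xi).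

Definition SR_std (R : realType) (m : nat) (a b : state R m) : R :=
  Num.max (Num.max (sigma_max (jac (@flux R m) a))
                   (sigma_max (jac (@flux R m) b))) 0.
Definition SL_std (R : realType) (m : nat) (a b : state R m) : R :=
  Num.min (Num.min (sigma_min (jac (@flux R m) a))
                   (sigma_min (jac (@flux R m) b))) 0.

(* The two integrals common to both entropy-stability speeds, based at a in
   direction d, and the denominator; SL_ES uses them at b in direction a - b. *)
Definition ES_hess_flux (R : realType) (m : nat) (a d : state R m) : R :=
  \int[lebesgue_measure]_(xi in `[0, 1])
    (\int[lebesgue_measure]_(zeta in `[0, xi])
      ((d^T *m hess (@entropy R m) (a + zeta *: d)
        *m jac (@flux R m) (a + xi *: d) *m d) 0 0)).
Definition ES_source (R : realType) (m : nat) (a d : state R m) : R :=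
  \int[lebesgue_measure]_(xi in `[0, 1])
    ((grad (@entropy R m) (a + xi *: d) *m source (a + xi *: d)
      *m dBx R m *m d) 0 0).
Definition ES_hess (R : realType) (m : nat) (a d : state R m) : R :=
  \int[lebesgue_measure]_(xi in `[0, 1])
    (\int[lebesgue_measure]_(zeta in `[0, xi])
      ((d^T *m hess (@entropy R m) (a + zeta *: d) *m d) 0 0)).

Definition SR_ES (R : realType) (m : nat) (a b : state R m)
    (Phi : R -> state R m) : R :=
  (ES_hess_flux a (b - a) + ES_source a (b - a)
   - (grad (@entropy R m) a *m path_integral Phi) 0 0) / ES_hess a (b - a).
Definition SL_ES (R : realType) (m : nat) (a b : state R m)
    (Phi : R -> state R m) : R :=
  (ES_hess_flux b (a - b) + ES_source b (a - b)
   + (grad (@entropy R m) b *m path_integral Phi) 0 0) / ES_hess b (a - b).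

Definition SR (R : realType) (m : nat) (a b : state R m)
    (Phi : R -> state R m) : R :=
  if a == b then SR_std a b else Num.max (SR_std a b) (SR_ES a b Phi).
Definition SL (R : realType) (m : nat) (a b : state R m)
    (Phi : R -> state R m) : R :=
  if a == b then SL_std a b else Num.min (SL_std a b) (SL_ES a b Phi).

Definition num_flux (R : realType) (m : nat) (a b : state R m)
    (Phi : R -> state R m) : state R m :=
  (SR a b Phi - SL a b Phi)^-1 *:
    (SR a b Phi *: flux a - SL a b Phi *: flux b
     + (SR a b Phi * SL a b Phi) *: (b - a)).

Definition num_entropy_flux (R : realType) (m : nat) (a b : state R m)
    (Phi : R -> state R m) : R :=
  (SR a b Phi * entropy_flux a - SL a b Phi * entropy_flux b
   + SR a b Phi * SL a b Phi * (entropy b - entropy a))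
  / (SR a b Phi - SL a b Phi).

Definition fluct_p (R : realType) (m : nat) (a b : state R m)
    (Phi : R -> state R m) : state R m :=
  (SR a b Phi / (SR a b Phi - SL a b Phi)) *: path_integral Phi.
Definition fluct_m (R : realType) (m : nat) (a b : state R m)
    (Phi : R -> state R m) : state R m :=
  (- SL a b Phi / (SR a b Phi - SL a b Phi)) *: path_integral Phi.

Definition T1 (R : realType) (m : nat) (b c : state R m)
    (Phi2 : R -> state R m) : R :=
  num_entropy_flux b c Phi2 - entropy_flux b
  - (grad (@entropy R m) b *m
       (num_flux b c Phi2 - flux b + fluct_m b c Phi2)) 0 0.
Definition T2 (R : realType) (m : nat) (a b : state R m)
    (Phi1 : R -> state R m) : R :=
  num_entropy_flux a b Phi1 - entropy_flux b
  - (grad (@entropy R m) b *m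
       (num_flux a b Phi1 - flux b - fluct_p a b Phi1)) 0 0.
Definition T3 (R : realType) (m : nat) (a b c : state R m)
    (Phi1 Phi2 : R -> state R m) : state R m :=
  num_flux b c Phi2 - num_flux a b Phi1 + fluct_m b c Phi2 + fluct_p a b Phi1.

Definition three_point (R : realType) (m : nat) (a b c : state R m)
    (Phi1 Phi2 : R -> state R m) (mu : R) : state R m :=
  b - mu *: T3 a b c Phi1 Phi2.

(* sigma_max of the Hessian is continuous on the (compact) segment, so that
   this sup is a maximum. *)
Definition max_hess (R : realType) (m : nat) (a b : state R m) : R :=
  sup [set sigma_max (hess (@entropy R m) (a + t *: (b - a))) | t in `[0, 1]].

Definition cfl (R : realType) (m : nat) (a b c : state R m)
    (Phi1 Phi2 : R -> state R m) (mu : R) : Prop :=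
  let bnew := three_point a b c Phi1 Phi2 mu in
  let D := T3 a b c Phi1 Phi2 in
  admissible bnew /\
  (D = 0 \/
   mu <= 2 * (T2 a b Phi1 - T1 b c Phi2) / dotv D D * (max_hess b bnew)^-1).

(* N-point Gauss-Lobatto rule on [a, b], with weights normalized by the length
   of the interval: the end points are nodes and the degree of exactness is
   2 N - 3. Nodes and weights are indexed by 1, ..., N; taking p = 1 shows that
   the weights sum to 1. *)
Definition gauss_lobatto (R : realType) (N : nat) (a b : R) (x w : nat -> R) :
    Prop :=
  [/\ (2 <= N)%N, x 1%N = a, x N = b,
      (forall q r : nat, (1 <= q)%N -> (q < r)%N -> (r <= N)%N -> x q < x r)
    & forall p : {poly R}, (size p <= 2 * N - 2)%N ->
        \sum_(1 <= q < N.+1) w q * p.[x q]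
        = (b - a)^-1 * \int[lebesgue_measure]_(t in `[a, b]) p.[t]].

(* A DG function is given by its polynomial on each cell; x j stands for
   x_{j + 1/2}, so that cell j is [x (j - 1), x j]. *)
Notation dgfun R m := (int -> 'cV[{poly R}]_(sdim m)).

Definition cell_eval (R : realType) (m : nat) (c : 'cV[{poly R}]_(sdim m))
    (t : R) : state R m :=
  \col_j (c j 0).[t].

Definition mesh (R : realType) (h : R) (x : int -> R) : Prop :=
  0 < h /\ forall j, x j - x (j - 1) = h.

Definition dg_function (R : realType) (m k : nat) (x : int -> R)
    (U : dgfun R m) : Prop :=
  (forall j l, (size (U j l 0%R) <= k.+1)%N) /\
  (forall j (t : R), x (j - 1) <= t <= x j -> admissible (cell_eval (U j) t)).

Definition trace_m (R : realType) (m : nat) (x : int -> R) (U : dgfun R m)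
    (j : int) : state R m :=
  cell_eval (U j) (x j).
Definition trace_p (R : realType) (m : nat) (x : int -> R) (U : dgfun R m)
    (j : int) : state R m :=
  cell_eval (U (j + 1)) (x j).

Definition iface_path (R : realType) (m : nat)
    (Psi : R -> state R m -> state R m -> state R m) (x : int -> R)
    (U : dgfun R m) (j : int) : R -> state R m :=
  fun xi => Psi xi (trace_m x U j) (trace_p x U j).

(* The portion over [a, b] of the path drawn by a polynomial, reparametrized
   over [0, 1]. *)
Definition cell_path (R : realType) (m : nat) (c : 'cV[{poly R}]_(sdim m))
    (a b : R) : R -> state R m :=
  fun xi => cell_eval c (a + xi * (b - a)).

Definition cell_average (R : realType) (m : nat) (x : int -> R)
    (U : dgfun R m) (i : int) : state R m :=
  (x i - x (i - 1))^-1 *: vintegral (x (i - 1)) (x i) (cell_eval (U i)).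

Definition dg_update (R : realType) (m : nat)
    (Psi : R -> state R m -> state R m -> state R m) (x : int -> R)
    (U : dgfun R m) (lambda : R) (i : int) : state R m :=
  let Fhat j := num_flux (trace_m x U j) (trace_p x U j)
                         (iface_path Psi x U j) in
  let Dm j := fluct_m (trace_m x U j) (trace_p x U j)
                      (iface_path Psi x U j) in
  let Dp j := fluct_p (trace_m x U j) (trace_p x U j)
                      (iface_path Psi x U j) in
  cell_average x U i
  - lambda *: (Fhat i - Fhat (i - 1))
  - lambda *: (Dm i + Dp (i - 1))
  - lambda *: vintegral (x (i - 1)) (x i)
      (fun t => (deriv (U i (iBx m) 0)).[t] *: source (cell_eval (U i) t)).

Definition weak_cell_entropy (R : realType) (m : nat)
    (Psi : R -> state R m -> state R m -> state R m) (x : int -> R)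
    (U : dgfun R m) (lambda : R) (i : int) (N : nat) (xhat w : nat -> R) :
    Prop :=
  let Ehat j := num_entropy_flux (trace_m x U j) (trace_p x U j)
                                 (iface_path Psi x U j) in
  entropy (dg_update Psi x U lambda i)
  <= \sum_(1 <= q < N.+1) w q * entropy (cell_eval (U i) (xhat q))
     - lambda * (Ehat i - Ehat (i - 1)).

(* Main.v *)
(** Both entropy-stability speeds are quotients whose denominator is the Bregman
    divergence of the convex entropy and whose numerator, by the compatibility
    relation between entropy, flux and source, is the matching divergence of the
    entropy flux minus the path term. The speed conditions therefore say exactly
    that [T1 <= 0 <= T2]. A second-order Taylor expansion of the entropy along the
    update, with the Hessian bounded by its largest eigenvalue, turns the CFL
    condition into the entropy inequality of the three-point scheme. The cell
    average update is the convex combination, with the positive Gauss-Lobatto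
    weights, of the nodal values and of two or three such three-point updates: the
    interior fluxes cancel and their fluctuations add up to the path integral over
    the cell, which is the volume source term. Jensen's inequality concludes. *)

Require Import Defs.
From mathcomp Require Import all_boot all_order all_algebra.
From mathcomp Require Import all_classical all_reals all_analysis.
From mathcomp Require Import ring lra zify.

Set Implicit Arguments.
Unset Strict Implicit.
Unset Printing Implicit Defensive.

Import Order.TTheory GRing.Theory Num.Theory.
Import numFieldNormedType.Exports.

Local Open Scope classical_set_scope.
Local Open Scope ring_scope.

(** * Directional derivatives and integrals on an interval *)

(** The speeds and the CFL condition are stated through directional derivatives and suprema of
    eigenvalues. Every derivative is therefore put in closed form, linear or bilinear in the
    increments, so that compatibility and strict convexity become algebraic identities. The formulas
    with logarithms hold only on admissible states, so derivatives are compared along lines, where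
    admissibility persists for small parameters. The eigenvalue bound rests on a variational
    argument for symmetric matrices, and the supremum over a segment bounds its elements only once
    the set is known to be bounded.

    Coinciding states are the other obstacle. The denominator of the entropy-stability speeds
    vanishes for [a = b], and the signs of [T1] and [T2] must then come from a vanishing path
    integral. Prescribed paths between equal states are constant, but a cell polynomial with equal
    end values may draw a loop with nonzero path integral. A node with another value cuts the loop
    into two paths with distinct end states; if there is none, the polynomial is constant. *)

Section DirectionalDerivative.
Variables (R : realType) (V : normedModType R).
Implicit Types (f g : V -> R) (x v : V).

Lemma is_derive_add f g x v (a b : R) : is_derive x v f a ->
  is_derive x v g b -> is_derive x v (fun y => f y + g y) (a + b).
Proof. exact: is_deriveD. Qed.

Lemma is_derive_sub f g x v (a b : R) : is_derive x v f a ->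
  is_derive x v g b -> is_derive x v (fun y => f y - g y) (a - b).
Proof. exact: is_deriveB. Qed.

Lemma is_derive_mul f g x v (a b : R) : is_derive x v f a ->
  is_derive x v g b -> is_derive x v (fun y => f y * g y) (a * g x + f x * b).
Proof.
move=> fa gb; have H := @is_deriveM _ _ f g x v a b fa gb.
by apply: (is_derive_eq (f' := f x *: b + g x *: a)) => //; rewrite addrC mulrC.
Qed.

Lemma is_derive_const (c : R) x v : is_derive x v (fun=> c) 0.
Proof. exact: is_derive_cst. Qed.

Lemma is_derive_mull (c : R) f x v (a : R) : is_derive x v f a ->
  is_derive x v (fun y => c * f y) (c * a).
Proof. exact: is_deriveZ. Qed.

Lemma is_derive_inv f x v (a : R) : f x != 0 -> is_derive x v f a ->
  is_derive x v (fun y => (f y)^-1) (- a / f x ^+ 2).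
Proof.
move=> fx0 fa; split; first by apply: derivableV.
by rewrite deriveV// derive_val /GRing.scale/= mulrC mulrN mulNr.
Qed.

Lemma is_derive_bigsum n (f : 'I_n -> V -> R) x v (a : 'I_n -> R) :
  (forall i, is_derive x v (f i) (a i)) ->
  is_derive x v (fun y => \sum_(i < n) f i y) (\sum_(i < n) a i).
Proof.
move=> fa; rewrite (_ : (fun y => _) = \sum_(i < n) f i); first exact: is_derive_sum.
by apply/funext => y; rewrite fct_sumE.
Qed.

(** Both sides have the same difference quotients, so rules for one real variable transfer to
    directional derivatives. *)
Lemma is_derive_lineP f x v t (a : R) :
  is_derive (x + t *: v) v f a <-> is_derive t 1 (fun s : R => f (x + s *: v)) a.
Proof.
have E : (fun h : R => h^-1 *: ((f \o shift (x + t *: v)) (h *: v) - f (x + t *: v)))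
  = (fun h : R => h^-1 *: (((fun s : R => f (x + s *: v)) \o shift t) (h *: 1)
        - f (x + t *: v))).
  apply/funext => h /=; congr (_ *: (f _ - _)).
  by rewrite scalerDl [in h *: 1]/GRing.scale/= mulr1 addrCA.
by split=> -[d e]; split; move: d e; rewrite /derivable /derive E.
Qed.

Lemma is_derive_ln_comp f x v (a : R) : 0 < f x -> is_derive x v f a ->
  is_derive x v (fun y => ln (f y)) (a / f x).
Proof.
move=> fx0 fa.
have /is_derive_lineP fl : is_derive (x + 0 *: v) v f a by rewrite scale0r addr0.
rewrite -[x]addr0 -(scale0r v); apply/is_derive_lineP.
apply: is_derive_eq.
  apply: (@is_derive1_comp _ (@ln R) (fun s : R => f (x + s *: v))).
  by apply: is_derive1_ln; rewrite scale0r addr0.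
by rewrite scale0r addr0 mulrC.
Qed.

End DirectionalDerivative.

Section OneVariable.
Variable R : realType.
Implicit Types (f g F : R -> R) (a b t : R).

Lemma is_derive_continuous f t a : is_derive t 1 f a -> {for t, continuous f}.
Proof.
by move=> fa; apply/differentiable_continuous/derivable1_diffP/ex_derive.
Qed.

Lemma continuous_itv f a b : (forall t, a <= t <= b -> {for t, continuous f}) ->
  {within `[a, b], continuous f}.
Proof.
move=> cf; apply: continuous_in_subspaceT => t /set_mem /=.
by rewrite in_itv /= => /cf.
Qed.

Lemma continuous_itv_integrable f a b :
  (forall t, a <= t <= b -> {for t, continuous f}) ->
  (@lebesgue_measure R).-integrable `[a, b] (EFin \o f).
Proof.
move=> cf; apply: continuous_compact_integrable; first exact: segment_compact.
exact: continuous_itv.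
Qed.

Lemma Rintegral_antiderivative f F a b : a <= b ->
  (forall t, a <= t <= b -> is_derive t 1 F (f t)) ->
  (forall t, a <= t <= b -> {for t, continuous f}) ->
  \int[lebesgue_measure]_(t in `[a, b]) f t = F b - F a.
Proof.
(* The degenerate interval does occur: the inner integrals of the speeds run over [[0, xi]] down to
   [xi = 0]. *)
rewrite le_eqVlt => /predU1P[->|ab] dF cf.
  by rewrite set_itv1 Rintegral_set1 subrr.
have cF t : a <= t <= b -> {for t, continuous F}.
  by move=> /dF; exact: is_derive_continuous.
have lab : a <= b := ltW ab.
rewrite /Rintegral (@continuous_FTC2 _ _ F)//.
- exact: continuous_itv.
- split.
  + by move=> t /[!in_itv]/= /andP[at_ tb]; apply/ex_derive/dF; rewrite !ltW.
  + by apply: cvg_at_right_filter; apply: cF; rewrite lexx.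
  + by apply: cvg_at_left_filter; apply: cF; rewrite lexx lab.
- move=> t /[!in_itv]/= /andP[at_ tb].
  have dt : is_derive t 1 F (f t) by apply: dF; rewrite !ltW.
  by rewrite derive1E derive_val.
Qed.

Lemma is_derive_MVT f (df : R -> R) a b : a < b ->
  (forall t, a <= t <= b -> is_derive t 1 f (df t)) ->
  exists2 c, a < c < b & f b - f a = df c * (b - a).
Proof.
move=> ab dF; have [c cab E] : exists2 c, c \in `]a, b[ & f b - f a = df c * (b - a).
  apply: MVT => // [t /[!in_itv]/= /andP[at_ tb]|]; first by apply: dF; rewrite !ltW.
  by apply: continuous_itv => t /dF; exact: is_derive_continuous.
by exists c => //; move: cab; rewrite in_itv.
Qed.

(** Two mean value steps: [g 1 - g 0 = dg c] with [c > 0], and [dg c - dg 0] is [c] times a value of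
    [ddg]. *)
Lemma second_order_gt0 g (dg ddg : R -> R) :
  (forall t, 0 <= t <= 1 -> is_derive t 1 g (dg t)) ->
  (forall t, 0 <= t <= 1 -> is_derive t 1 dg (ddg t)) ->
  (forall t, 0 <= t <= 1 -> 0 < ddg t) -> 0 < g 1 - g 0 - dg 0.
Proof.
move=> d1 d2 p; have [c /andP[c0 c1] ->] := is_derive_MVT ltr01 d1.
have d3 t : 0 <= t <= c -> is_derive t 1 dg (ddg t) by move=> tc; apply: d2; lra.
have [e /andP[e0 ec] E] := is_derive_MVT c0 d3.
by rewrite subr0 mulr1 E mulr_gt0 ?subr_gt0// p; lra.
Qed.

(** Two mean value steps on [g] itself would only give the remainder [M]. Taking the first one on
    [M / 2 * s ^ 2 - g s] yields the sharp [M / 2], the origin of the factor 2 in the CFL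
    condition. *)
Lemma second_order_le g (dg ddg : R -> R) (M : R) :
  (forall t, 0 <= t <= 1 -> is_derive t 1 g (dg t)) ->
  (forall t, 0 <= t <= 1 -> is_derive t 1 dg (ddg t)) ->
  (forall t, 0 <= t <= 1 -> ddg t <= M) -> g 1 <= g 0 + dg 0 + M / 2.
Proof.
move=> d1 d2 p.
have dX (t : R) : is_derive t 1 (fun s : R => s) 1 by exact: is_derive_id.
have e1 t : 0 <= t <= 1 ->
    is_derive t 1 (fun s => M / 2 * (s * s) - g s) (M * t - dg t).
  move=> /d1 h; have := is_derive_sub (is_derive_mull (M / 2) (is_derive_mul (dX t) (dX t))) h.
  by move/is_derive_eq; apply; field.
have [c /andP[c0 c1] Ec] := is_derive_MVT ltr01 e1.
have d3 t : 0 <= t <= c -> is_derive t 1 dg (ddg t) by move=> tc; apply: d2; lra.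
have [e /andP[e0 ec] E] := is_derive_MVT c0 d3.
have pe : ddg e <= M by apply: p; lra.
have : dg c - dg 0 <= M * c by rewrite E subr0 ler_wpM2r// ltW.
move: Ec; lra.
Qed.

Lemma Rintegral_affine f a b : a < b ->
  (forall t, a <= t <= b -> {for t, continuous f}) ->
  \int[lebesgue_measure]_(s in `[0, 1]) ((b - a) * f (a + s * (b - a))) =
  \int[lebesgue_measure]_(t in `[a, b]) f t.
Proof.
move=> ab cf.
pose A s := a + s * (b - a).
have dA (s : R) : is_derive s 1 A (b - a).
  have := is_derive_add (is_derive_const a s 1)
    (is_derive_mul (is_derive_id s 1) (is_derive_const (b - a) s 1)).
  by move/is_derive_eq; apply; rewrite add0r mulr0 addr0 mul1r.
have A0 : A 0 = a by rewrite /A mul0r addr0.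
have A1 : A 1 = b by rewrite /A mul1r addrC subrK.
have dAE : A^`()%classic = fun=> b - a by apply/funext => s; rewrite derive1E derive_val.
rewrite /Rintegral -[in RHS]A0 -[in RHS]A1.
rewrite (@integration_by_substitution_increasing _ A f 0 1)//.
- by congr fine; apply: eq_integral => s _; rewrite /= dAE mulrC.
- by move=> s t _ _ st; rewrite /A ltrD2l ltr_pM2r// subr_gt0.
- by rewrite dAE => s _; exact: cvg_cst.
- by rewrite dAE; exact: is_cvg_cst.
- by rewrite dAE; exact: is_cvg_cst.
- split; first by move=> s _; exact: ex_derive.
  + by apply: cvg_at_right_filter; exact: is_derive_continuous.
  + by apply: cvg_at_left_filter; exact: is_derive_continuous.
- by rewrite A0 A1; exact: continuous_itv.
Qed.

Lemma Rintegral_split f a b c : a <= c -> c <= b ->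
  (forall t, a <= t <= b -> {for t, continuous f}) ->
  \int[lebesgue_measure]_(t in `[a, b]) f t =
  \int[lebesgue_measure]_(t in `[a, c]) f t +
  \int[lebesgue_measure]_(t in `[c, b]) f t.
Proof.
move=> ac cb cf.
have fi := continuous_itv_integrable cf.
have := @Rintegral_itvB _ f (BLeft a) (BRight b) c fi; rewrite !bnd_simp => /(_ ac cb).
rewrite Rintegral_itv_obnd_cbnd; first by move=> <-; rewrite addrC subrK.
apply: (integrableS _ _ _ fi) => //.
by apply: subset_itvr; rewrite bnd_simp.
Qed.

End OneVariable.

(** * States and explicit derivatives *)

Section DotProduct.
Variables (R : realType) (n : nat).
Implicit Types (u v w : 'cV[R]_n).

Lemma dotvC u v : dotv u v = dotv v u.
Proof. by apply: eq_bigr => j _; rewrite mulrC. Qed.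

Lemma dotvDr u v w : dotv u (v + w) = dotv u v + dotv u w.
Proof. by rewrite /dotv -big_split; apply: eq_bigr => j _; rewrite mxE mulrDr. Qed.

Lemma dotvZr c u v : dotv u (c *: v) = c * dotv u v.
Proof. by rewrite /dotv mulr_sumr; apply: eq_bigr => j _; rewrite mxE mulrCA. Qed.

Lemma dotvNr u v : dotv u (- v) = - dotv u v.
Proof. by rewrite -scaleN1r dotvZr mulN1r. Qed.

Lemma dotvBr u v w : dotv u (v - w) = dotv u v - dotv u w.
Proof. by rewrite dotvDr dotvNr. Qed.

Lemma dotvDl u v w : dotv (v + w) u = dotv v u + dotv w u.
Proof. by rewrite !(dotvC _ u) dotvDr. Qed.

Lemma dotvZl c u v : dotv (c *: v) u = c * dotv v u.
Proof. by rewrite !(dotvC _ u) dotvZr. Qed.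

Lemma dotvBl u v w : dotv (v - w) u = dotv v u - dotv w u.
Proof. by rewrite !(dotvC _ u) dotvBr. Qed.

Lemma dotvv_ge0 u : 0 <= dotv u u.
Proof. by apply: sumr_ge0 => j _; rewrite -expr2 sqr_ge0. Qed.

Lemma dotvv_eq0 u : (dotv u u == 0) = (u == 0).
Proof.
apply/eqP/eqP => [/eqP|->]; last first.
  by rewrite /dotv big1// => j _; rewrite mxE mul0r.
rewrite psumr_eq0 => [/allP u0|j _]; last by rewrite -expr2 sqr_ge0.
apply/colP => j; rewrite mxE; apply/eqP.
by rewrite -[_ == 0]orbb -mulf_eq0 (eqP (u0 j (mem_index_enum _))).
Qed.

Lemma dotvv_gt0 u : (0 < dotv u u) = (u != 0).
Proof. by rewrite lt_neqAle dotvv_ge0 andbT eq_sym dotvv_eq0. Qed.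

Lemma dotv_mx u v : dotv u v = (u^T *m v) 0 0.
Proof. by rewrite mxE; apply: eq_bigr => j _; rewrite mxE. Qed.

End DotProduct.

Lemma dotv_delta (R : realType) n (u : 'cV[R]_n) j : dotv u (delta_mx j 0) = u j 0.
Proof.
rewrite /dotv (bigD1 j)//= big1 ?addr0; first by rewrite mxE !eqxx mulr1.
by move=> k kj; rewrite mxE (negbTE kj) mulr0.
Qed.

Section States.
Variables (R : realType) (m : nat).
Implicit Types (U V W : state R m) (c : R).

Definition i_rho : 'I_(sdim m) := lshift _ ord0.
Definition i_mom (i : 'I_m.+1) : 'I_(sdim m) := rshift 1 (lshift _ i).
Definition i_energy : 'I_(sdim m) := rshift 1 (rshift m.+1 (lshift m.+1 (ord0 : 'I_1))).
Definition i_mag (i : 'I_m.+1) : 'I_(sdim m) := rshift 1 (rshift m.+1 (rshift 1 i)).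

Lemma rhoE U : rho U = U i_rho 0. Proof. by rewrite /rho mxE. Qed.
Lemma momE U i : mom U i 0 = U (i_mom i) 0. Proof. by rewrite /mom !mxE. Qed.
Lemma energyE U : energy U = U i_energy 0. Proof. by rewrite /energy !mxE. Qed.
Lemma magE U i : mag U i 0 = U (i_mag i) 0. Proof. by rewrite /mag !mxE. Qed.
Lemma BxE U : Bx U = mag U ord0 0. Proof. by rewrite magE. Qed.
Lemma velE U i : vel U i 0 = (rho U)^-1 * mom U i 0. Proof. by rewrite /vel mxE. Qed.

Lemma state_components U V : rho U = rho V -> mom U = mom V ->
  energy U = energy V -> mag U = mag V -> U = V.
Proof.
rewrite !rhoE !energyE => r /colP q e /colP B; apply/colP => i.
case: (split_ordP i) => {}i ->; first by rewrite ord1.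
case: (split_ordP i) => {}i ->; first by move: (q i); rewrite !momE.
case: (split_ordP i) => {}i ->; first by rewrite ord1.
by move: (B i); rewrite !magE.
Qed.

Lemma rhoD U V : rho (U + V) = rho U + rho V. Proof. by rewrite !rhoE mxE. Qed.
Lemma rhoZ c U : rho (c *: U) = c * rho U. Proof. by rewrite !rhoE mxE. Qed.
Lemma momD U V : mom (U + V) = mom U + mom V.
Proof. by rewrite /mom !linearD. Qed.
Lemma momZ c U : mom (c *: U) = c *: mom U.
Proof. by rewrite /mom !linearZ. Qed.
Lemma energyD U V : energy (U + V) = energy U + energy V.
Proof. by rewrite !energyE mxE. Qed.
Lemma energyZ c U : energy (c *: U) = c * energy U.
Proof. by rewrite !energyE mxE. Qed.
Lemma magD U V : mag (U + V) = mag U + mag V.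
Proof. by rewrite /mag !linearD. Qed.
Lemma magZ c U : mag (c *: U) = c *: mag U.
Proof. by rewrite /mag !linearZ. Qed.
Lemma BxD U V : Bx (U + V) = Bx U + Bx V. Proof. by rewrite /Bx mxE. Qed.
Lemma BxZ c U : Bx (c *: U) = c * Bx U. Proof. by rewrite /Bx mxE. Qed.

Section Mkstate.
Variables (r e : R) (q B : 'cV[R]_m.+1).
Lemma rho_mkstate : rho (mkstate r q e B) = r.
Proof. by rewrite /rho /mkstate col_mxKu mxE. Qed.
Lemma mom_mkstate : mom (mkstate r q e B) = q.
Proof. by rewrite /mom /mkstate col_mxKd col_mxKu. Qed.
Lemma energy_mkstate : energy (mkstate r q e B) = e.
Proof. by rewrite /energy /mkstate !col_mxKd col_mxKu mxE. Qed.
Lemma mag_mkstate : mag (mkstate r q e B) = B.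
Proof. by rewrite /mag /mkstate !col_mxKd. Qed.
End Mkstate.
Definition mkstateE := (rho_mkstate, mom_mkstate, energy_mkstate, mag_mkstate).

Lemma mom_vel U : rho U != 0 -> mom U = rho U *: vel U.
Proof. by move=> r0; rewrite /vel scalerA divff// scale1r. Qed.

(** This and the following definitions are the derivatives at [U] in the direction [V], and then
    [W], expressed through the velocity and pressure increments. *)
Definition dvel U V : 'cV[R]_m.+1 := (rho U)^-1 *: (mom V - rho V *: vel U).

Definition dpressure U V : R := (gamma R - 1) *
  (energy V - dotv (vel U) (mom V) + 2^-1 * dotv (vel U) (vel U) * rho V
   - dotv (mag U) (mag V)).

Definition d2pressure U V W : R := - (gamma R - 1) *
  (rho U * dotv (dvel U V) (dvel U W) + dotv (mag V) (mag W)).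

Definition dtotal_pressure U V : R := dpressure U V + dotv (mag U) (mag V).

Definition dentropy U V : R := - (rho V * (spec_entropy U - gamma R)
  + rho U * (dpressure U V / pressure U)) / (gamma R - 1).

Definition d2entropy U V W : R := - (
  (rho V * dpressure U W + rho W * dpressure U V) / pressure U
  - gamma R * rho V * rho W / rho U
  - rho U * dpressure U V * dpressure U W / pressure U ^+ 2
  + rho U * d2pressure U V W / pressure U) / (gamma R - 1).

Definition dflux U V : state R m :=
  let du := dvel U V in let dux := du ord0 0 in
  mkstate (rho V * ux U + rho U * dux)
    ((rho V * ux U + rho U * dux) *: vel U + (rho U * ux U) *: du
     + dtotal_pressure U V *: delta_mx ord0 0 - (Bx V *: mag U + Bx U *: mag V))
    (dux * (energy U + total_pressure U)
     + ux U * (energy V + dtotal_pressure U V)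
     - (Bx V * dotv (vel U) (mag U)
        + Bx U * (dotv du (mag U) + dotv (vel U) (mag V))))
    (dux *: mag U + ux U *: mag V - (Bx V *: vel U + Bx U *: du)).

Lemma mom_flux U i : mom (flux U) i 0 = rho U * ux U * vel U i 0
  + total_pressure U * (delta_mx ord0 0 : 'cV[R]_m.+1) i 0 - Bx U * mag U i 0.
Proof.
rewrite /flux mom_mkstate; move: (vel U) (mag U) => u B.
by rewrite !mxE.
Qed.

Lemma mag_flux U i : mag (flux U) i 0 = ux U * mag U i 0 - Bx U * vel U i 0.
Proof.
rewrite /flux mag_mkstate; move: (vel U) (mag U) => u B.
by rewrite !mxE.
Qed.

Lemma rho_dflux U V : rho (dflux U V) = rho V * ux U + rho U * dvel U V ord0 0.
Proof. exact: rho_mkstate. Qed.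

Lemma energy_dflux U V : energy (dflux U V) =
  dvel U V ord0 0 * (energy U + total_pressure U)
  + ux U * (energy V + dtotal_pressure U V)
  - (Bx V * dotv (vel U) (mag U)
     + Bx U * (dotv (dvel U V) (mag U) + dotv (vel U) (mag V))).
Proof. exact: energy_mkstate. Qed.

Lemma mom_dflux U V i : mom (dflux U V) i 0 =
  (rho V * ux U + rho U * dvel U V ord0 0) * vel U i 0
  + rho U * ux U * dvel U V i 0
  + dtotal_pressure U V * (delta_mx ord0 0 : 'cV[R]_m.+1) i 0
  - (Bx V * mag U i 0 + Bx U * mag V i 0).
Proof.
rewrite /dflux /= mom_mkstate.
move: (vel U) (mag U) (dvel U V) (mag V) => u B du dB.
by rewrite !mxE.
Qed.

Lemma mag_dflux U V i : mag (dflux U V) i 0 =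
  dvel U V ord0 0 * mag U i 0 + ux U * mag V i 0
  - (Bx V * vel U i 0 + Bx U * dvel U V i 0).
Proof.
rewrite /dflux /= mag_mkstate.
move: (vel U) (mag U) (dvel U V) (mag V) => u B du dB.
by rewrite !mxE.
Qed.

Definition dentropy_flux U V : R :=
  dentropy U V * ux U + entropy U * dvel U V ord0 0.

Lemma gamma_sub1 : gamma R - 1 = 2 / 3. Proof. by rewrite /gamma; field. Qed.

Lemma dentropy_source U : dentropy U (source U)
  = rho U / pressure U * dotv (vel U) (mag U).
Proof.
rewrite /dentropy /dpressure /source !mkstateE (dotvC (mag U)) gamma_sub1.
by move: (pressure U)^-1 (dotv _ _) => p d; field.
Qed.

(** The relation [F_ent' = U' F' + phi B_x'] tested on the increment [V]. It becomes a rational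
    identity in a few dot products, which [field] settles, once conservative increments are replaced
    by primitive ones. *)
Lemma dflux_compat U V : admissible U ->
  dentropy U (dflux U V) + dentropy U (source U) * Bx V = dentropy_flux U V.
Proof.
move=> [r0 p0]; rewrite dentropy_source.
have rn : rho U != 0 by rewrite gt_eqF.
have pn : pressure U != 0 by rewrite gt_eqF.
(* Change to primitive variables: momentum and energy increments are eliminated in favour of those
   of velocity and pressure. *)
have vmom : mom V = rho U *: dvel U V + rho V *: vel U.
  by rewrite /dvel scalerA divff// scale1r subrK.
have vE : energy V = (gamma R - 1)^-1 * dpressure U V + dotv (vel U) (mom V)
    - 2^-1 * dotv (vel U) (vel U) * rho V + dotv (mag U) (mag V).
  by rewrite /dpressure gamma_sub1; field.
have uE : energy U = (gamma R - 1)^-1 * pressure U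
    + 2^-1 * rho U * dotv (vel U) (vel U) + 2^-1 * dotv (mag U) (mag U).
  by rewrite /pressure gamma_sub1; field.
rewrite /dentropy_flux {1}/dentropy {1}/dpressure /dflux !mkstateE.
rewrite vE vmom uE /total_pressure /dtotal_pressure.
rewrite /entropy {1}/dentropy !gamma_sub1 !BxE (_ : gamma R = 5 / 3)// /ux.
move: (dpressure U V) (spec_entropy U) (dvel U V) (vel U) => dP s du u.
rewrite !(dotvDr, dotvBr, dotvNr, dotvZr) !dotv_delta.
rewrite (dotvC (mag U) u) (dotvC (mag U) du) (dotvC u du).
by field; rewrite ?rn ?pn.
Qed.

End States.

Lemma is_derive_coord (R : realType) n (x v : 'cV[R]_n) i :
  is_derive x v (fun y : 'cV[R]_n => y i 0) (v i 0).
Proof.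
rewrite -[x]addr0 -(scale0r v); apply/is_derive_lineP.
rewrite (_ : (fun s => _) = fun s => x i 0 + s * v i 0); last first.
  by apply/funext => s; rewrite !mxE.
have := is_derive_add (is_derive_const (x i 0) (0 : R) 1)
  (is_derive_mul (is_derive_id (0 : R) 1) (is_derive_const (v i 0) (0 : R) 1)).
by move/is_derive_eq; apply; rewrite add0r mulr0 addr0 mul1r.
Qed.

Lemma is_derive_dotv (R : realType) (V : normedModType R) n (f g : V -> 'cV[R]_n)
    x v (df dg : 'cV[R]_n) :
  (forall i, is_derive x v (fun y => f y i 0) (df i 0)) ->
  (forall i, is_derive x v (fun y => g y i 0) (dg i 0)) ->
  is_derive x v (fun y => dotv (f y) (g y)) (dotv df (g x) + dotv (f x) dg).
Proof.
move=> hf hg; rewrite /dotv -big_split /=.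
by apply: is_derive_bigsum => i; apply: is_derive_mul.
Qed.

(** A directional derivative sees only a short piece of the line through [x]; this is what allows
    formulas valid on admissible states alone. *)
Lemma near_line_is_derive (R : realType) (V : normedModType R) (f g : V -> R)
    x v a : (\forall t \near (0 : R), f (x + t *: v) = g (x + t *: v)) ->
  is_derive x v f a -> is_derive x v g a.
Proof.
move=> fg; have E : x + 0 *: v = x by rewrite scale0r addr0.
rewrite -E => /is_derive_lineP fa; apply/is_derive_lineP.
exact: near_eq_is_derive fa.
Qed.

Lemma is_derive_line (R : realType) (V : normedModType R) (f : V -> R) x v t a :
  is_derive (x + t *: v) v f a -> is_derive t 1 (fun s : R => f (x + s *: v)) a.
Proof. by move/is_derive_lineP. Qed.

Lemma line_continuous (R : realType) (V : normedModType R) (f : V -> R) x v t a :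
  is_derive (x + t *: v) v f a -> {for t, continuous (fun s : R => f (x + s *: v))}.
Proof. by move=> /is_derive_lineP; exact: is_derive_continuous. Qed.

(** The bridge from the coordinatewise gradient, Jacobian and Hessian to the closed forms. It also
    reduces continuity of a form with moving argument to continuity of coordinates. *)
Lemma linear_coord_sum (R : realType) n (f : 'cV[R]_n -> R) (v : 'cV[R]_n) :
  (forall x y, f (x + y) = f x + f y) -> (forall c x, f (c *: x) = c * f x) ->
  \sum_j v j 0 * f (delta_mx j 0) = f v.
Proof.
move=> fD fZ; have f0 : f 0 = 0 by rewrite -(scale0r 0) fZ mul0r.
rewrite [in RHS](matrix_sum_delta v) (big_morph f fD f0).
by apply: eq_bigr => j _; rewrite big_ord1 fZ.
Qed.

(** * Derivatives of pressure and entropy, and positivity of the entropy Hessian *)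

Section StateDerivatives.
Variables (R : realType) (m : nat).
Implicit Types (U V W : state R m).

Lemma is_derive_rho U V : is_derive U V (@rho R m) (rho V).
Proof.
rewrite (_ : @rho R m = fun y => y (i_rho m) 0) ?rhoE; first exact: is_derive_coord.
by apply/funext => y; rewrite rhoE.
Qed.

Lemma is_derive_energy U V : is_derive U V (@energy R m) (energy V).
Proof.
rewrite (_ : @energy R m = fun y => y (i_energy m) 0) ?energyE; first exact: is_derive_coord.
by apply/funext => y; rewrite energyE.
Qed.

Lemma is_derive_mom U V i : is_derive U V (fun y : state R m => mom y i 0) (mom V i 0).
Proof.
rewrite (_ : (fun y => _) = fun y : state R m => y (i_mom i) 0) ?momE; first exact: is_derive_coord.
by apply/funext => y; rewrite momE.
Qed.

Lemma is_derive_mag U V i : is_derive U V (fun y : state R m => mag y i 0) (mag V i 0).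
Proof.
rewrite (_ : (fun y => _) = fun y : state R m => y (i_mag i) 0) ?magE; first exact: is_derive_coord.
by apply/funext => y; rewrite magE.
Qed.

Lemma is_derive_vel U V i : rho U != 0 ->
  is_derive U V (fun y : state R m => vel y i 0) (dvel U V i 0).
Proof.
move=> r0; rewrite (_ : (fun y => _) = fun y : state R m => (rho y)^-1 * mom y i 0); last first.
  by apply/funext => y; rewrite velE.
have := is_derive_mul (is_derive_inv r0 (is_derive_rho U V)) (is_derive_mom U V i).
move/is_derive_eq; apply; rewrite /dvel !mxE; move: (mom U i 0) (mom V i 0) => a b.
by field.
Qed.

Lemma is_derive_pressure U V : rho U != 0 ->
  is_derive U V (@pressure R m) (dpressure U V).
Proof.
move=> r0; have dv i := is_derive_vel V i r0.
have := is_derive_mull (gamma R - 1) (is_derive_sub (is_derive_sub (is_derive_energy U V)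
  (is_derive_mul (is_derive_mull 2^-1 (is_derive_rho U V)) (is_derive_dotv dv dv)))
  (is_derive_mull 2^-1 (is_derive_dotv (is_derive_mag U V) (is_derive_mag U V)))).
move/is_derive_eq; apply; rewrite /dpressure; congr (_ * _).
have -> : mom V = rho U *: dvel U V + rho V *: vel U.
  by rewrite /dvel scalerA divff// scale1r subrK.
rewrite (dotvC (mag V)) (dotvC (dvel U V)).
move: (vel U) (dvel U V) => u du; rewrite !(dotvDr, dotvZr).
by field.
Qed.

(** Openness of the admissible set along lines, from the continuity of density and pressure;
    directional derivatives ask for no more. *)
Lemma near_line_admissible U V : admissible U ->
  \forall t \near (0 : R), admissible (U + t *: V).
Proof.
move=> [r0 p0].
have U0 : U + 0 *: V = U by rewrite scale0r addr0.
have cr : {for (0 : R), continuous (fun t : R => rho (U + t *: V))}.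
  exact: line_continuous (is_derive_rho _ _).
have cp : {for (0 : R), continuous (fun t : R => pressure (U + t *: V))}.
  by apply: line_continuous (is_derive_pressure _ _); rewrite U0 gt_eqF.
near=> t; split; near: t.
- by apply: (cvgr_gt _ cr); rewrite U0.
- by apply: (cvgr_gt _ cp); rewrite U0.
Unshelve. all: by end_near. Qed.

Lemma spec_entropyE U : admissible U ->
  spec_entropy U = ln (pressure U) - gamma R * ln (rho U).
Proof.
move=> [r0 p0]; rewrite /spec_entropy lnM ?posrE ?powR_gt0// ln_powR mulNr.
by [].
Qed.

Lemma is_derive_spec_entropy U V : admissible U -> is_derive U V (@spec_entropy R m)
  (dpressure U V / pressure U - gamma R * (rho V / rho U)).
Proof.
move=> aU; have [r0 p0] := aU.
apply: (@near_line_is_derive _ _ (fun y => ln (pressure y) - gamma R * ln (rho y))).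
  near=> t; rewrite spec_entropyE//; near: t.
  exact: near_line_admissible.
apply: is_derive_sub.
  by apply: is_derive_ln_comp => //; apply: is_derive_pressure; rewrite gt_eqF.
by apply: is_derive_mull; apply: is_derive_ln_comp => //; exact: is_derive_rho.
Unshelve. all: by end_near. Qed.

Lemma is_derive_entropy U V : admissible U ->
  is_derive U V (@entropy R m) (dentropy U V).
Proof.
move=> aU; have [r0 p0] := aU.
have H := is_derive_mull (- (gamma R - 1)^-1)
  (is_derive_mul (is_derive_rho U V) (is_derive_spec_entropy V aU)).
rewrite (_ : @entropy R m = fun y => - (gamma R - 1)^-1 * (rho y * spec_entropy y)).
  move: H => /is_derive_eq; apply; rewrite /dentropy gamma_sub1; field.
  by rewrite !gt_eqF.
by apply/funext => y; rewrite /entropy !mulNr mulrC.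
Qed.

Lemma is_derive_entropy_flux U V : admissible U ->
  is_derive U V (@entropy_flux R m) (dentropy_flux U V).
Proof.
move=> aU; have rn : rho U != 0 by rewrite gt_eqF// aU.1.
rewrite (_ : @entropy_flux R m = fun y => entropy y * vel y ord0 0).
  by apply: is_derive_mul; [exact: is_derive_entropy|exact: is_derive_vel].
by apply/funext => y; rewrite /entropy_flux /entropy /ux; ring.
Qed.

Lemma is_derive_dpressure U V W : rho U != 0 ->
  is_derive U W (fun y => dpressure y V) (d2pressure U V W).
Proof.
move=> r0; have dv i := is_derive_vel W i r0.
have dV i : is_derive U W (fun=> mom V i 0) ((0 : 'cV[R]_m.+1) i 0).
  by rewrite [X in is_derive _ _ _ X]mxE; exact: is_derive_const.
have dB i : is_derive U W (fun=> mag V i 0) ((0 : 'cV[R]_m.+1) i 0).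
  by rewrite [X in is_derive _ _ _ X]mxE; exact: is_derive_const.
have := is_derive_mull (gamma R - 1) (is_derive_sub (is_derive_add (is_derive_sub
  (is_derive_const (energy V) U W) (is_derive_dotv dv dV))
  (is_derive_mul (is_derive_mull 2^-1 (is_derive_dotv dv dv)) (is_derive_const (rho V) U W)))
  (is_derive_dotv (is_derive_mag U W) dB)).
move/is_derive_eq; apply; rewrite /d2pressure mulNr -mulrN; congr (_ * _).
have -> : mom V = rho U *: dvel U V + rho V *: vel U.
  by rewrite /dvel scalerA divff// scale1r subrK.
rewrite (dotvC (mag V)) (dotvC (vel U) (dvel U W)) (dotvC (dvel U V)).
have dotv0 (u : 'cV[R]_m.+1) : dotv u 0 = 0 by rewrite -(scale0r 0) dotvZr mul0r.
move: (vel U) (dvel U V) (dvel U W) => u du du'; rewrite !(dotvDr, dotvZr, dotv0).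
by field.
Qed.

Lemma is_derive_dentropy U V W : admissible U ->
  is_derive U W (fun y => dentropy y V) (d2entropy U V W).
Proof.
move=> aU; have [r0 p0] := aU; have rn : rho U != 0 by rewrite gt_eqF.
have pn : pressure U != 0 by rewrite gt_eqF.
have H := is_derive_mull (- (gamma R - 1)^-1) (is_derive_add
  (is_derive_mull (rho V) (is_derive_sub (is_derive_spec_entropy W aU)
     (is_derive_const (gamma R) U W)))
  (is_derive_mul (is_derive_rho U W) (is_derive_mul (is_derive_dpressure V W rn)
     (is_derive_inv pn (is_derive_pressure W rn))))).
rewrite (_ : (fun y => dentropy y V) = fun y => - (gamma R - 1)^-1 *
  (rho V * (spec_entropy y - gamma R) + rho y * (dpressure y V * (pressure y)^-1))).
  move: H => /is_derive_eq; apply; rewrite /d2entropy gamma_sub1; field.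
  by rewrite rn pn.
by apply/funext => y; rewrite /dentropy; ring.
Qed.

Lemma d2entropy_sym U V W : d2entropy U V W = d2entropy U W V.
Proof.
rewrite /d2entropy /d2pressure (dotvC (dvel U V)) (dotvC (mag V)).
by congr (- _ / _); rewrite addrC; ring.
Qed.

Lemma dvelD U V W : dvel U (V + W) = dvel U V + dvel U W.
Proof. by rewrite /dvel rhoD momD scalerDl opprD addrACA scalerDr. Qed.

Lemma dvelZ U c V : dvel U (c *: V) = c *: dvel U V.
Proof. by rewrite /dvel rhoZ momZ -scalerA -scalerBr !scalerA mulrC. Qed.

Lemma dpressureD U V W : dpressure U (V + W) = dpressure U V + dpressure U W.
Proof. by rewrite /dpressure rhoD momD energyD magD !dotvDr; ring. Qed.

Lemma dpressureZ U c V : dpressure U (c *: V) = c * dpressure U V.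
Proof. by rewrite /dpressure rhoZ momZ energyZ magZ !dotvZr; ring. Qed.

Lemma dentropyD U V W : dentropy U (V + W) = dentropy U V + dentropy U W.
Proof. by rewrite /dentropy rhoD dpressureD; ring. Qed.

Lemma dentropyZ U c V : dentropy U (c *: V) = c * dentropy U V.
Proof. by rewrite /dentropy rhoZ dpressureZ; ring. Qed.

Lemma dentropyN U V : dentropy U (- V) = - dentropy U V.
Proof. by rewrite -scaleN1r dentropyZ mulN1r. Qed.

Lemma dentropyB U V W : dentropy U (V - W) = dentropy U V - dentropy U W.
Proof. by rewrite dentropyD -scaleN1r dentropyZ mulN1r. Qed.

Lemma d2entropyDl U V V' W :
  d2entropy U (V + V') W = d2entropy U V W + d2entropy U V' W.
Proof.
by rewrite /d2entropy /d2pressure rhoD dpressureD dvelD magD !dotvDl; ring.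
Qed.

Lemma d2entropyZl U c V W : d2entropy U (c *: V) W = c * d2entropy U V W.
Proof.
by rewrite /d2entropy /d2pressure rhoZ dpressureZ dvelZ magZ !dotvZl; ring.
Qed.

Lemma d2entropyDr U V W W' :
  d2entropy U V (W + W') = d2entropy U V W + d2entropy U V W'.
Proof. by rewrite !(d2entropy_sym _ V) d2entropyDl. Qed.

Lemma d2entropyZr U c V W : d2entropy U V (c *: W) = c * d2entropy U V W.
Proof. by rewrite !(d2entropy_sym _ V) d2entropyZl. Qed.

(** The Hessian form is a sum of squares: [3 / 2] is [1 / (gamma - 1)], and the coefficient 1 of
    [X ^ 2] is [gamma / (gamma - 1) - 1 / (gamma - 1)]. If all squares vanish, so do the increments
    of density, velocity, pressure and field, hence those of momentum and energy. *)
Lemma d2entropy_gt0 U V : admissible U -> V != 0 -> 0 < d2entropy U V V.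
Proof.
move=> [r0 p0] V0; have rn : rho U != 0 by rewrite gt_eqF.
have pn : pressure U != 0 by rewrite gt_eqF.
set X := rho V; set Y := rho U * dpressure U V / pressure U.
have -> : d2entropy U V V = X ^+ 2 / rho U + 3 / 2 * (X - Y) ^+ 2 / rho U
    + rho U / pressure U * (rho U * dotv (dvel U V) (dvel U V) + dotv (mag V) (mag V)).
  rewrite /d2entropy /d2pressure gamma_sub1 (_ : gamma R = 5 / 3)// /X /Y.
  by field; rewrite rn pn.
have u0 := dotvv_ge0 (dvel U V); have b0 := dotvv_ge0 (mag V).
have rp : 0 < rho U / pressure U by rewrite divr_gt0.
have s1 : 0 <= X ^+ 2 / rho U by rewrite divr_ge0 ?sqr_ge0// ltW.
have s2 : 0 <= 3 / 2 * (X - Y) ^+ 2 / rho U.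
  by rewrite divr_ge0 ?(ltW r0)// mulr_ge0 ?sqr_ge0//; lra.
have s4 : 0 <= rho U * dotv (dvel U V) (dvel U V) by rewrite mulr_ge0// ltW.
have s3 : 0 <= rho U / pressure U *
    (rho U * dotv (dvel U V) (dvel U V) + dotv (mag V) (mag V)).
  by rewrite mulr_ge0 ?(ltW rp)// addr_ge0.
rewrite lt_neqAle addr_ge0 ?addr_ge0// andbT eq_sym.
apply: contra V0; rewrite paddr_eq0 ?addr_ge0// paddr_eq0//.
move=> /andP[/andP[e1 e2]]; rewrite mulf_eq0 gt_eqF//= paddr_eq0// => /andP[e3 e4].
have X0 : X = 0.
  by apply/eqP; move: e1; rewrite mulf_eq0 invr_eq0 (negbTE rn) orbF sqrf_eq0.
have du0 : dvel U V = 0.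
  by apply/eqP; move: e3; rewrite mulf_eq0 (negbTE rn) dotvv_eq0.
have B0 : mag V = 0 by apply/eqP; rewrite -dotvv_eq0.
have q0 : mom V = 0.
  move/eqP: du0; rewrite /dvel -/X X0 scale0r subr0 scaler_eq0 invr_eq0 (negbTE rn).
  by move=> /eqP.
have Y0 : Y = 0.
  move: e2; rewrite X0 sub0r sqrrN mulf_eq0 invr_eq0 (negbTE rn) orbF mulf_eq0.
  rewrite sqrf_eq0 => /orP[|/eqP//]; lra.
have dP0 : dpressure U V = 0.
  by apply/eqP; move/eqP: Y0; rewrite /Y !mulf_eq0 invr_eq0 (negbTE rn) (negbTE pn) /= orbF.
have E0 : energy V = 0.
  have dotv0 (u : 'cV[R]_m.+1) : dotv u 0 = 0 by rewrite -(scale0r 0) dotvZr mul0r.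
  move: dP0; rewrite /dpressure q0 B0 -/X X0 !dotv0 gamma_sub1; lra.
have z : (0 : state R m) = 0 *: V by rewrite scale0r.
apply/eqP; apply: state_components.
- by rewrite z rhoZ mul0r.
- by rewrite z momZ scale0r.
- by rewrite z energyZ mul0r.
- by rewrite z magZ scale0r.
Qed.

End StateDerivatives.

(** * Continuity along curves *)

(* Automatic implicit arguments would see through [{for t, continuous f}] and
   make the neighbourhood it quantifies over implicit. *)
Unset Implicit Arguments.

Section PointwiseContinuity.
Context {R : realType} {T : topologicalType}.
Implicit Types (f g : T -> R) (t : T).

Lemma cont_const (c : R) t : {for t, continuous (fun=> c : R)}.
Proof. exact: cvg_cst. Qed.

Lemma cont_add {f g t} : {for t, continuous f} -> {for t, continuous g} ->
  {for t, continuous (fun s => f s + g s)}.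
Proof. by move=> cf cg; exact: (cvgD cf cg). Qed.

Lemma cont_sub {f g t} : {for t, continuous f} -> {for t, continuous g} ->
  {for t, continuous (fun s => f s - g s)}.
Proof. by move=> cf cg; exact: (cvgB cf cg). Qed.

Lemma cont_mul {f g t} : {for t, continuous f} -> {for t, continuous g} ->
  {for t, continuous (fun s => f s * g s)}.
Proof. by move=> cf cg; exact: (cvgM cf cg). Qed.

Lemma cont_mull (c : R) {f t} : {for t, continuous f} ->
  {for t, continuous (fun s => c * f s)}.
Proof. by move=> cf; exact: (cont_mul (cont_const c t) cf). Qed.

Lemma cont_inv {f t} : f t != 0 -> {for t, continuous f} ->
  {for t, continuous (fun s => (f s)^-1)}.
Proof. by move=> f0 cf; exact: (cvgV f0 cf). Qed.

Lemma cont_sum {I : Type} {r : seq I} {f : I -> T -> R} {t} :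
  (forall i, {for t, continuous (f i)}) ->
  {for t, continuous (fun s => \sum_(i <- r) f i s)}.
Proof.
move=> cf; elim: r => [|i r IH].
  rewrite (_ : (fun _ => _) = fun=> 0) ?big_nil; first exact: cont_const.
  by apply/funext => s; rewrite big_nil.
rewrite (_ : (fun _ => _) = fun s => f i s + \sum_(j <- r) f j s).
  exact: cont_add.
by apply/funext => s; rewrite big_cons.
Qed.

Lemma cont_dotv {n} {f g : T -> 'cV[R]_n} {t} :
  (forall i, {for t, continuous (fun s => f s i 0)}) ->
  (forall i, {for t, continuous (fun s => g s i 0)}) ->
  {for t, continuous (fun s => dotv (f s) (g s))}.
Proof. by move=> cf cg; apply: cont_sum => i; apply: cont_mul. Qed.

End PointwiseContinuity.

Section CurveContinuity.
Context {R : realType} {m : nat} {c : R -> state R m} {t : R}.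
Hypothesis cc : forall i, {for t, continuous (fun s => c s i 0)}.
Hypothesis at_ : admissible (c t).
Implicit Types (V W : state R m).

Let rn : rho (c t) != 0. Proof. by rewrite gt_eqF// at_.1. Qed.
Let pn : pressure (c t) != 0. Proof. by rewrite gt_eqF// at_.2. Qed.

Lemma cont_rho : {for t, continuous (fun s => rho (c s))}.
Proof.
by rewrite (_ : (fun s => _) = fun s => c s (i_rho m) 0)//; apply/funext => s; rewrite rhoE.
Qed.

Lemma cont_energy : {for t, continuous (fun s => energy (c s))}.
Proof.
by rewrite (_ : (fun s => _) = fun s => c s (i_energy m) 0)//; apply/funext => s; rewrite energyE.
Qed.

Lemma cont_mom i : {for t, continuous (fun s => mom (c s) i 0)}.
Proof.
by rewrite (_ : (fun s => _) = fun s => c s (i_mom i) 0)//; apply/funext => s; rewrite momE.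
Qed.

Lemma cont_mag i : {for t, continuous (fun s => mag (c s) i 0)}.
Proof.
by rewrite (_ : (fun s => _) = fun s => c s (i_mag i) 0)//; apply/funext => s; rewrite magE.
Qed.

Lemma cont_rhoV : {for t, continuous (fun s => (rho (c s))^-1)}.
Proof. exact: (cont_inv (f := fun s => rho (c s)) rn cont_rho). Qed.

Lemma cont_vel i : {for t, continuous (fun s => vel (c s) i 0)}.
Proof.
rewrite (_ : (fun s => _) = fun s => (rho (c s))^-1 * mom (c s) i 0).
  exact: (cont_mul cont_rhoV (cont_mom i)).
by apply/funext => s; rewrite velE.
Qed.

Lemma cont_ux : {for t, continuous (fun s => ux (c s))}.
Proof. exact: cont_vel. Qed.

Lemma cont_pressure : {for t, continuous (fun s => pressure (c s))}.
Proof.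
exact: (cont_mull (gamma R - 1) (cont_sub (cont_sub cont_energy
  (cont_mul (cont_mull 2^-1 cont_rho) (cont_dotv cont_vel cont_vel)))
  (cont_mull 2^-1 (cont_dotv cont_mag cont_mag)))).
Qed.

Lemma cont_pressureV : {for t, continuous (fun s => (pressure (c s))^-1)}.
Proof. exact: (cont_inv (f := fun s => pressure (c s)) pn cont_pressure). Qed.

Lemma cont_dvel V i : {for t, continuous (fun s => dvel (c s) V i 0)}.
Proof.
rewrite (_ : (fun s => _) =
    fun s => (rho (c s))^-1 * (mom V i 0 - rho V * vel (c s) i 0)).
  exact: (cont_mul cont_rhoV (cont_sub (cont_const _ _) (cont_mull _ (cont_vel i)))).
by apply/funext => s; rewrite [LHS]mxE; congr (_ * _); rewrite !mxE.
Qed.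

Lemma cont_dpressure V : {for t, continuous (fun s => dpressure (c s) V)}.
Proof.
have ck (w : 'cV[R]_m.+1) i : {for t, continuous (fun=> w i 0 : R)} := cont_const _ _.
exact: (cont_mull _ (cont_sub (cont_add (cont_sub (cont_const _ _)
  (cont_dotv cont_vel (ck _))) (cont_mul (cont_mull _ (cont_dotv cont_vel cont_vel))
  (cont_const _ _))) (cont_dotv cont_mag (ck _)))).
Qed.

Lemma cont_d2entropy V W : {for t, continuous (fun s => d2entropy (c s) V W)}.
Proof.
have c2 : {for t, continuous (fun s => d2pressure (c s) V W)}.
  exact: (cont_mull _ (cont_add (cont_mul cont_rho
    (cont_dotv (cont_dvel V) (cont_dvel W))) (cont_const _ _))).
rewrite (_ : (fun s => _) = fun s => - (gamma R - 1)^-1 * (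
    (rho V * dpressure (c s) W + rho W * dpressure (c s) V) * (pressure (c s))^-1
    - gamma R * rho V * rho W * (rho (c s))^-1
    - (rho (c s) * dpressure (c s) V) * (dpressure (c s) W
        * ((pressure (c s))^-1 * (pressure (c s))^-1))
    + rho (c s) * (d2pressure (c s) V W * (pressure (c s))^-1))).
  have cP := cont_dpressure; have cV := cont_pressureV.
  exact: (cont_mull _ (cont_add (cont_sub (cont_sub
    (cont_mul (cont_add (cont_mull _ (cP W)) (cont_mull _ (cP V))) cV)
    (cont_mull _ cont_rhoV)) (cont_mul (cont_mul cont_rho (cP V)) (cont_mul (cP W)
    (cont_mul cV cV)))) (cont_mul cont_rho (cont_mul c2 cV)))).
by apply/funext => s; rewrite /d2entropy expr2 (invfM (pressure _)); ring.
Qed.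

Lemma cont_source i : {for t, continuous (fun s => source (c s) i 0)}.
Proof.
case: (split_ordP i) => {}i ->.
  rewrite (_ : (fun s => _) = fun=> 0); first exact: cont_const.
  by apply/funext => s; rewrite ord1 -[lshift _ _]/(i_rho m) -rhoE mkstateE.
case: (split_ordP i) => {}i ->.
  rewrite (_ : (fun s => _) = fun s => mag (c s) i 0); first exact: cont_mag.
  by apply/funext => s; rewrite -[rshift _ _]/(i_mom i) -momE mkstateE.
case: (split_ordP i) => {}i ->.
  rewrite (_ : (fun s => _) = fun s => dotv (vel (c s)) (mag (c s))).
    exact: (cont_dotv cont_vel cont_mag).
  by apply/funext => s; rewrite ord1 -[rshift _ _]/(i_energy m) -energyE mkstateE.
rewrite (_ : (fun s => _) = fun s => vel (c s) i 0); first exact: cont_vel.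
by apply/funext => s; rewrite -[rshift _ _]/(i_mag i) -magE mkstateE.
Qed.

Lemma cont_dflux V i : {for t, continuous (fun s => dflux (c s) V i 0)}.
Proof.
have ck (w : 'cV[R]_m.+1) j : {for t, continuous (fun=> w j 0 : R)} := cont_const _ _.
have cP : {for t, continuous (fun s => dtotal_pressure (c s) V)}.
  exact: (cont_add (cont_dpressure V) (cont_dotv cont_mag (ck _))).
have cT : {for t, continuous (fun s => total_pressure (c s))}.
  exact: (cont_add cont_pressure (cont_mull _ (cont_dotv cont_mag cont_mag))).
have cB : {for t, continuous (fun s => Bx (c s))} := cc _.
have cu := cont_dvel V ord0; have cr := cont_rho; have cx := cont_ux.
have ce := cont_energy.
have cm : {for t, continuous
    (fun s => rho V * ux (c s) + rho (c s) * dvel (c s) V ord0 0)}.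
  exact: (cont_add (cont_mull _ cx) (cont_mul cr cu)).
case: (split_ordP i) => {}i ->.
  rewrite (_ : (fun s => _) = fun s => rho V * ux (c s) + rho (c s) * dvel (c s) V ord0 0)//.
  by apply/funext => s; rewrite ord1 -[lshift _ _]/(i_rho m) -rhoE mkstateE.
case: (split_ordP i) => {}i ->.
  rewrite (_ : (fun s => _) = fun s =>
     (rho V * ux (c s) + rho (c s) * dvel (c s) V ord0 0) * vel (c s) i 0
     + (rho (c s) * ux (c s)) * dvel (c s) V i 0
     + dtotal_pressure (c s) V * (delta_mx ord0 0 : 'cV[R]_m.+1) i 0
     - (Bx V * mag (c s) i 0 + Bx (c s) * mag V i 0)).
    exact: (cont_sub (cont_add (cont_add (cont_mul cm (cont_vel i))
      (cont_mul (cont_mul cr cx) (cont_dvel V i))) (cont_mul cP (cont_const _ _)))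
      (cont_add (cont_mull _ (cont_mag i)) (cont_mul cB (cont_const _ _)))).
  by apply/funext => s; rewrite -[rshift _ _]/(i_mom i) -momE mom_dflux.
case: (split_ordP i) => {}i ->.
  rewrite (_ : (fun s => _) = fun s => dvel (c s) V ord0 0 * (energy (c s) + total_pressure (c s))
     + ux (c s) * (energy V + dtotal_pressure (c s) V)
     - (Bx V * dotv (vel (c s)) (mag (c s))
        + Bx (c s) * (dotv (dvel (c s) V) (mag (c s)) + dotv (vel (c s)) (mag V)))).
    exact: (cont_sub (cont_add (cont_mul cu (cont_add ce cT))
      (cont_mul cx (cont_add (cont_const _ _) cP)))
      (cont_add (cont_mull _ (cont_dotv cont_vel cont_mag)) (cont_mul cB
      (cont_add (cont_dotv (cont_dvel V) cont_mag) (cont_dotv cont_vel (ck _)))))).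
  by apply/funext => s; rewrite ord1 -[rshift _ _]/(i_energy m) -energyE mkstateE.
rewrite (_ : (fun s => _) = fun s =>
   dvel (c s) V ord0 0 * mag (c s) i 0 + ux (c s) * mag V i 0
   - (Bx V * vel (c s) i 0 + Bx (c s) * dvel (c s) V i 0)).
  exact: (cont_sub (cont_add (cont_mul cu (cont_mag i)) (cont_mul cx (cont_const _ _)))
    (cont_add (cont_mull _ (cont_vel i)) (cont_mul cB (cont_dvel V i)))).
by apply/funext => s; rewrite -[rshift _ _]/(i_mag i) -magE mag_dflux.
Qed.

End CurveContinuity.

Set Implicit Arguments.

(** * The entropy-stability integrals *)

Section MatrixForms.
Variables (R : realType) (m : nat).
Implicit Types (U V W a d : state R m).

Lemma is_derive_flux U V i : rho U != 0 ->
  is_derive U V (fun y : state R m => flux y i 0) (dflux U V i 0).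
Proof.
move=> r0.
have dr := is_derive_rho U V; have dE := is_derive_energy U V.
have du j := is_derive_vel V j r0; have dB := is_derive_mag U V.
have dux : is_derive U V (@ux R m) (dvel U V ord0 0) := du ord0.
have dBx : is_derive U V (@Bx R m) (Bx V) := is_derive_coord _ _ _.
have dP : is_derive U V (@total_pressure R m) (dtotal_pressure U V).
  have H := is_derive_add (is_derive_pressure V r0) (is_derive_mull 2^-1 (is_derive_dotv dB dB)).
    apply: (is_derive_eq H); rewrite /dtotal_pressure (dotvC (mag V)).
  by field.
case: (split_ordP i) => {}i ->.
  rewrite (_ : (fun y => _) = fun y : state R m => rho y * ux y).
    have H := is_derive_mul dr dux.
    apply: (is_derive_eq H).
    by rewrite ord1 -[lshift _ _]/(i_rho m) -rhoE mkstateE.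
  by apply/funext => y; rewrite ord1 -[lshift _ _]/(i_rho m) -rhoE mkstateE.
case: (split_ordP i) => {}i ->.
  rewrite (_ : (fun y => _) = fun y : state R m => rho y * ux y * vel y i 0
    + total_pressure y * (delta_mx ord0 0 : 'cV[R]_m.+1) i 0 - Bx y * mag y i 0).
    have H := is_derive_sub (is_derive_add (is_derive_mul (is_derive_mul dr dux) (du i))
      (is_derive_mul dP
      (is_derive_const ((delta_mx ord0 0 : 'cV[R]_m.+1) i 0) U V))) (is_derive_mul dBx (dB i)).
    apply: (is_derive_eq H).
    by rewrite -[rshift _ _]/(i_mom i) -momE mom_dflux mulr0 addr0.
  by apply/funext => y; rewrite -[rshift _ _]/(i_mom i) -momE mom_flux.
case: (split_ordP i) => {}i ->.
  rewrite (_ : (fun y => _) = fun y : state R m => ux y * (energy y + total_pressure y)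
    - Bx y * dotv (vel y) (mag y)).
    have H := is_derive_sub (is_derive_mul dux (is_derive_add dE dP))
      (is_derive_mul dBx (is_derive_dotv du dB)).
    apply: (is_derive_eq H).
    by rewrite ord1 -[rshift _ _]/(i_energy m) -energyE mkstateE.
  by apply/funext => y; rewrite ord1 -[rshift _ _]/(i_energy m) -energyE mkstateE.
rewrite (_ : (fun y => _) = fun y : state R m => ux y * mag y i 0 - Bx y * vel y i 0).
  have H := is_derive_sub (is_derive_mul dux (dB i)) (is_derive_mul dBx (du i)).
    apply: (is_derive_eq H).
  by rewrite -[rshift _ _]/(i_mag i) -magE mag_dflux.
by apply/funext => y; rewrite -[rshift _ _]/(i_mag i) -magE mag_flux.
Qed.

Lemma dtotal_pressureD U V W :
  dtotal_pressure U (V + W) = dtotal_pressure U V + dtotal_pressure U W.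
Proof. by rewrite /dtotal_pressure dpressureD magD dotvDr; ring. Qed.

Lemma dtotal_pressureZ U c V : dtotal_pressure U (c *: V) = c * dtotal_pressure U V.
Proof. by rewrite /dtotal_pressure dpressureZ magZ dotvZr; ring. Qed.

Lemma dfluxD U V W : dflux U (V + W) = dflux U V + dflux U W.
Proof.
have uD i : dvel U (V + W) i 0 = dvel U V i 0 + dvel U W i 0 by rewrite dvelD mxE.
have BD i : mag (V + W) i 0 = mag V i 0 + mag W i 0 by rewrite magD mxE.
move: (rho_dflux U (V + W)) (rho_dflux U V) (rho_dflux U W)
  (mom_dflux U (V + W)) (mom_dflux U V) (mom_dflux U W)
  (energy_dflux U (V + W)) (energy_dflux U V) (energy_dflux U W)
  (mag_dflux U (V + W)) (mag_dflux U V) (mag_dflux U W).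
move: (dflux U (V + W)) (dflux U V) (dflux U W) => X Y Z rX rY rZ qX qY qZ eX eY eZ bX bY bZ.
apply: state_components.
- by rewrite rhoD rX rY rZ (rhoD V W) uD; ring.
- apply/colP => i; rewrite momD [RHS]mxE qX qY qZ (rhoD V W) !uD dtotal_pressureD.
  by rewrite (BxD V W) BD; ring.
- rewrite energyD eX eY eZ uD (energyD V W) dtotal_pressureD (BxD V W) dvelD.
  by rewrite (magD V W) dotvDl dotvDr; ring.
- by apply/colP => i; rewrite magD [RHS]mxE bX bY bZ !uD (BxD V W) BD; ring.
Qed.

Lemma dfluxZ U c V : dflux U (c *: V) = c *: dflux U V.
Proof.
have uZ i : dvel U (c *: V) i 0 = c * dvel U V i 0 by rewrite dvelZ mxE.
have BZ i : mag (c *: V) i 0 = c * mag V i 0 by rewrite magZ mxE.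
move: (rho_dflux U (c *: V)) (rho_dflux U V)
  (mom_dflux U (c *: V)) (mom_dflux U V)
  (energy_dflux U (c *: V)) (energy_dflux U V)
  (mag_dflux U (c *: V)) (mag_dflux U V).
move: (dflux U (c *: V)) (dflux U V) => X Y rX rY qX qY eX eY bX bY.
apply: state_components.
- by rewrite rhoZ rX rY (rhoZ c V) uZ; ring.
- apply/colP => i; rewrite momZ [RHS]mxE qX qY (rhoZ c V) !uZ dtotal_pressureZ.
  by rewrite (BxZ c V) BZ; ring.
- rewrite energyZ eX eY uZ (energyZ c V) dtotal_pressureZ (BxZ c V) dvelZ.
  by rewrite (magZ c V) dotvZl dotvZr; ring.
- by apply/colP => i; rewrite magZ [RHS]mxE bX bY !uZ (BxZ c V) BZ; ring.
Qed.

Lemma gradE U V : admissible U -> (grad (@entropy R m) U *m V) 0 0 = dentropy U V.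
Proof.
move=> aU; rewrite -(linear_coord_sum _ (dentropyD U) (dentropyZ U)) mxE.
apply: eq_bigr => j _; rewrite mxE mulrC; congr (_ * _).
by have [] := is_derive_entropy (delta_mx j 0) aU.
Qed.

Lemma jacE U V : admissible U -> jac (@flux R m) U *m V = dflux U V.
Proof.
move=> [r0 _]; apply/colP => i.
rewrite -(@linear_coord_sum _ _ (fun W => dflux U W i 0)).
- rewrite mxE; apply: eq_bigr => j _; rewrite mxE mulrC; congr (_ * _).
  have rn : rho U != 0 by rewrite gt_eqF.
  by have [] := is_derive_flux (delta_mx j 0) i rn.
- by move=> x y; rewrite dfluxD mxE.
- by move=> c x; rewrite dfluxZ mxE.
Qed.

(** The inner derivative agrees with [dentropy] only at admissible states. Near [U] the line
    consists of such states, which is enough for the outer derivative. *)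
Lemma hess_entry U i j : admissible U ->
  hess (@entropy R m) U i j = d2entropy U (delta_mx j 0) (delta_mx i 0).
Proof.
move=> aU; rewrite mxE.
apply: (@derive_val _ _ _ _ _ (fun V => 'D_(delta_mx j 0) (@entropy R m) V)).
apply: (near_line_is_derive _ (is_derive_dentropy _ _ aU)).
near=> t; symmetry; apply: (@derive_val _ _ _ _ _ (@entropy R m)).
apply: is_derive_entropy; near: t; exact: near_line_admissible.
Unshelve. all: by end_near. Qed.

Lemma hessE U V W : admissible U ->
  (V^T *m hess (@entropy R m) U *m W) 0 0 = d2entropy U W V.
Proof.
move=> aU; rewrite -mulmxA mxE.
rewrite -(linear_coord_sum _ (d2entropyDr U W) (fun c => d2entropyZr U c W)).
apply: eq_bigr => i _; rewrite mxE; congr (_ * _).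
have D2 x y : d2entropy U (x + y) (delta_mx i 0) =
  d2entropy U x (delta_mx i 0) + d2entropy U y (delta_mx i 0) by exact: d2entropyDl.
rewrite -(linear_coord_sum _ D2 (fun c x => d2entropyZl U c x _)) mxE.
by apply: eq_bigr => j _; rewrite hess_entry// mulrC.
Qed.

Lemma hess_sym U : admissible U ->
  (hess (@entropy R m) U)^T = hess (@entropy R m) U.
Proof. by move=> aU; apply/matrixP => i j; rewrite mxE !hess_entry// d2entropy_sym. Qed.

End MatrixForms.

Section EntropyStableSpeeds.
Variables (R : realType) (m : nat) (a d : state R m).
Hypothesis seg : forall t : R, 0 <= t <= 1 -> admissible (a + t *: d).

Let p0 : a + 0 *: d = a. Proof. by rewrite scale0r addr0. Qed.
Let p1 : a + 1 *: d = a + d. Proof. by rewrite scale1r. Qed.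

Let line_coord t i : {for t, continuous (fun s : R => (a + s *: d) i 0)}.
Proof. exact: line_continuous (is_derive_coord _ _ _). Qed.

(** The second direction [w] is left free to serve both the denominator, where [w = d], and the
    numerator, where [w = F'(a + xi d) d] depends on the outer variable. *)
Lemma ES_hess_inner (w : state R m) (xi : R) : 0 <= xi <= 1 ->
  \int[lebesgue_measure]_(zeta in `[0, xi])
     ((d^T *m hess (@entropy R m) (a + zeta *: d) *m w) 0 0)
  = dentropy (a + xi *: d) w - dentropy a w.
Proof.
move=> /andP[x0 x1].
transitivity (\int[lebesgue_measure]_(zeta in `[0, xi]) d2entropy (a + zeta *: d) w d).
  apply: eq_Rintegral => z /set_mem/=; rewrite in_itv/= => /andP[z0 zx].
  by rewrite hessE//; apply: seg; rewrite z0 (le_trans zx).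
have z01 z : 0 <= z <= xi -> 0 <= z <= 1.
  by move=> /andP[z0 zx]; rewrite z0 (le_trans zx).
have dF z (zx : 0 <= z <= xi) := is_derive_line (is_derive_dentropy w d (seg (z01 z zx))).
rewrite (Rintegral_antiderivative x0 dF); first by rewrite p0.
by move=> z zx; apply: cont_d2entropy => //; exact/seg/z01.
Qed.

Lemma ES_hessE : ES_hess a d = entropy (a + d) - entropy a - dentropy a d.
Proof.
transitivity (\int[lebesgue_measure]_(xi in `[0, 1])
    (dentropy (a + xi *: d) d - dentropy a d)).
  by apply: eq_Rintegral => z /set_mem/=; rewrite in_itv/=; exact: ES_hess_inner.
have dF (t : R) : 0 <= t <= 1 ->
    is_derive t 1 (fun z => entropy (a + z *: d) - z * dentropy a d)
      (dentropy (a + t *: d) d - dentropy a d).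
  move=> t01; have H := is_derive_sub (is_derive_line (is_derive_entropy d (seg t01)))
    (is_derive_mul (is_derive_id t 1) (is_derive_const (dentropy a d) t 1)).
  by apply: (is_derive_eq H); rewrite mulr0 addr0 mul1r.
rewrite (Rintegral_antiderivative ler01 dF).
  rewrite p0 p1 mul1r mul0r.
  by move: (entropy (a + d)) (entropy a) (dentropy a d) => e1 e0 e; ring.
move=> t t01; apply: cont_sub; last exact: cont_const.
exact: line_continuous (is_derive_dentropy d d (seg t01)).
Qed.


(* The entropy compatibility [F_ent' = U' F' + phi B_x'] makes the sum of the two
   integrands an exact derivative. *)
Lemma ES_numeratorE : ES_hess_flux a d + ES_source a d =
  entropy_flux (a + d) - entropy_flux a - dentropy a (flux (a + d) - flux a).
Proof.
pose p t := a + t *: d.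
pose f t := dentropy (p t) (dflux (p t) d) - dentropy a (dflux (p t) d).
pose g t := dentropy (p t) (source (p t)) * Bx d.
have -> : ES_hess_flux a d = \int[lebesgue_measure]_(t in `[0, 1]) f t.
  apply: eq_Rintegral => z /set_mem/=; rewrite in_itv/= => z01.
  rewrite /f /p -ES_hess_inner//; apply: eq_Rintegral => y _.
  by rewrite -mulmxA jacE//; exact: seg.
have -> : ES_source a d = \int[lebesgue_measure]_(t in `[0, 1]) g t.
  apply: eq_Rintegral => z /set_mem/=; rewrite in_itv/= => z01.
  rewrite -!mulmxA mulmxA mxE big_ord1 gradE; last exact: seg.
  by rewrite /g /dBx -rowE mxE.
have cde t : 0 <= t <= 1 -> forall b, {for t, continuous (fun s => dentropy (p s) b)}.
  by move=> t01 b; apply: line_continuous (is_derive_dentropy _ _ _); exact: seg.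
have cdf t : 0 <= t <= 1 -> forall j, {for t, continuous (fun s => dflux (p s) d j 0)}.
  by move=> t01 j; apply: cont_dflux => //; exact: seg.
have cf t : 0 <= t <= 1 -> {for t, continuous f}.
  move=> t01.
  (* In [dentropy (p s) (dflux (p s) d)] base point and increment both move; expanding on the basis
     leaves products of functions already known to be continuous. *)
  rewrite (_ : f = fun s => (\sum_j dflux (p s) d j 0 * dentropy (p s) (delta_mx j 0))
     - \sum_j dflux (p s) d j 0 * dentropy a (delta_mx j 0)).
    apply: cont_sub; apply: cont_sum => j; apply: cont_mul; first exact: cdf.
    - exact: cde.
    - exact: cdf.
    - exact: cont_const.
  apply/funext => s; rewrite (linear_coord_sum _ (dentropyD (p s)) (dentropyZ (p s))).
  by rewrite (linear_coord_sum _ (dentropyD a) (dentropyZ a)).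
have cg t : 0 <= t <= 1 -> {for t, continuous g}.
  move=> t01; apply: cont_mul; last exact: cont_const.
  rewrite (_ : (fun s => _) =
     fun s => \sum_j source (p s) j 0 * dentropy (p s) (delta_mx j 0)).
    apply: cont_sum => j; apply: cont_mul; last exact: cde.
    by apply: cont_source => //; exact: seg.
  by apply/funext => s; rewrite (linear_coord_sum _ (dentropyD (p s)) (dentropyZ (p s))).
rewrite -RintegralD//; [|exact: continuous_itv_integrable..].
(* An antiderivative of [f + g]: the form [U'(a)] stays frozen, so only the entropy flux and the
   flux are differentiated along the segment. *)
pose F t := entropy_flux (p t) - \sum_j flux (p t) j 0 * dentropy a (delta_mx j 0).
have lsum (X : state R m) : \sum_j X j 0 * dentropy a (delta_mx j 0) = dentropy a X.
  exact: linear_coord_sum (dentropyD a) (dentropyZ a).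
have F1 : F 1 = entropy_flux (a + d) - dentropy a (flux (a + d)).
  by rewrite /F lsum (p1 : p 1 = _).
have F0 : F 0 = entropy_flux a - dentropy a (flux a).
  rewrite /F lsum (p0 : p 0 = _); reflexivity.
have dF (t : R) : 0 <= t <= 1 -> is_derive t 1 F (f t + g t).
  move=> t01; have at_ := seg t01.
  have H := is_derive_sub (is_derive_line (is_derive_entropy_flux d at_))
    (is_derive_bigsum (fun j => is_derive_mul
      (is_derive_line (is_derive_flux d j (lt0r_neq0 at_.1)))
      (is_derive_const (dentropy a (delta_mx j 0)) t 1))).
  apply: (is_derive_eq H); rewrite -dflux_compat//.
  have -> : \sum_j (dflux (a + t *: d) d j 0 * dentropy a (delta_mx j 0) +
      flux (a + t *: d) j 0 * 0) = dentropy a (dflux (p t) d).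
    by rewrite -lsum; apply: eq_bigr => j _; rewrite mulr0 addr0.
  by rewrite /f /g addrAC.
have cfg (t : R) : 0 <= t <= 1 -> {for t, continuous (fun s => f s + g s)}.
  by move=> t01; apply: cont_add; [exact: cf|exact: cg].
rewrite (Rintegral_antiderivative ler01 dF cfg) F1 F0.
rewrite (dentropyB a (flux (a + d)) (flux a)).
move: (entropy_flux (a + d)) (entropy_flux a) (dentropy a (flux (a + d)))
  (dentropy a (flux a)) => e1 e0 g1 g0; ring.
Qed.

Lemma ES_hess_gt0 : d != 0 -> 0 < ES_hess a d.
Proof.
move=> d0; rewrite ES_hessE.
have := @second_order_gt0 R (fun t => entropy (a + t *: d))
  (fun t => dentropy (a + t *: d) d) (fun t => d2entropy (a + t *: d) d d).
rewrite p0 p1; apply => t t01.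
- exact: is_derive_line (is_derive_entropy d (seg _)).
- exact: is_derive_line (is_derive_dentropy d d (seg _)).
- by apply: d2entropy_gt0 => //; exact: seg.
Qed.

Lemma entropy_taylor_le (M : R) :
  (forall t : R, 0 <= t <= 1 -> d2entropy (a + t *: d) d d <= M) ->
  entropy (a + d) <= entropy a + dentropy a d + M / 2.
Proof.
move=> dM; have := @second_order_le R (fun t => entropy (a + t *: d))
  (fun t => dentropy (a + t *: d) d) (fun t => d2entropy (a + t *: d) d d) M.
rewrite p0 p1; apply => // t t01.
- exact: is_derive_line (is_derive_entropy d (seg _)).
- exact: is_derive_line (is_derive_dentropy d d (seg _)).
Qed.

End EntropyStableSpeeds.

(** * Convexity of the entropy *)

(** If the sum vanished, every weight would vanish. Zero weights must be allowed for the end points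
    of a segment. *)
Lemma sum_weights_gt0 (R : realType) (I : eqType) (r : seq I) (w f : I -> R) :
  {in r, forall q, 0 <= w q} -> \sum_(q <- r) w q = 1 ->
  {in r, forall q, 0 < f q} -> 0 < \sum_(q <- r) w q * f q.
Proof.
move=> w0 w1 f0; have wf0 q : q \in r -> 0 <= w q * f q.
  by move=> qr; rewrite mulr_ge0 ?w0// ltW ?f0.
rewrite big_seq lt_neqAle sumr_ge0 ?andbT//; apply/negP => /eqP/esym/eqP.
rewrite psumr_eq0// => /allP h.
suff : \sum_(q <- r) w q = 0 by rewrite w1 => /eqP; rewrite oner_eq0.
rewrite big_seq big1// => q qr; have := h q qr; rewrite qr /= mulf_eq0.
by rewrite (gt_eqF (f0 _ qr)) orbF => /eqP.
Qed.

Section AdmissibleConvex.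
Variables (R : realType) (m : nat).
Implicit Types (U : state R m).

(* [pressure / (gamma - 1)] is the minimum over [v] and [b] of these functionals,
   which are linear in the state; hence it is concave. *)
Let L (v b : 'cV[R]_m.+1) U := energy U - dotv v (mom U) + 2^-1 * dotv v v * rho U
  - dotv b (mag U) + 2^-1 * dotv b b.

Let pressure_min v b U : 0 < rho U -> pressure U / (gamma R - 1) <= L v b U.
Proof.
move=> r0; have rn : rho U != 0 by rewrite gt_eqF.
(* Completing the squares in [v] and [b] exhibits the gap as nonnegative, with equality at the
   velocity and field of [U]. *)
have -> : L v b U = pressure U / (gamma R - 1)
    + 2^-1 * rho U * dotv (vel U - v) (vel U - v) + 2^-1 * dotv (mag U - b) (mag U - b).
  rewrite /L /pressure gamma_sub1 (mom_vel rn).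
  move: (vel U) (mag U) (energy U) => u B e.
  rewrite !(dotvBl, dotvBr) dotvZr (dotvC u v) (dotvC B b).
  by field.
by rewrite -addrA lerDl addr_ge0// mulr_ge0 ?dotvv_ge0//; lra.
Qed.

Let pressure_minE U : 0 < rho U -> L (vel U) (mag U) U = pressure U / (gamma R - 1).
Proof.
move=> r0; have rn : rho U != 0 by rewrite gt_eqF.
rewrite /L /pressure gamma_sub1 (mom_vel rn).
by move: (vel U) (mag U) => u B; rewrite dotvZr; field.
Qed.

(** Take [v] and [b] to be the velocity and field of the average, where [L] equals
    [pressure / (gamma - 1)]. With weights of sum 1 the affine [L] passes to the average, and at
    each [X q] it is at least the positive value [pressure / (gamma - 1)]. *)
Lemma admissible_sum (I : eqType) (r : seq I) (w : I -> R) (X : I -> state R m) :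
  {in r, forall q, 0 <= w q} -> \sum_(q <- r) w q = 1 ->
  {in r, forall q, admissible (X q)} -> admissible (\sum_(q <- r) w q *: X q).
Proof.
move=> w0 w1 aX; set Y := \sum_(q <- r) _.
have lin (f : state R m -> R) : (forall x y, f (x + y) = f x + f y) ->
    (forall c x, f (c *: x) = c * f x) -> f Y = \sum_(q <- r) w q * f (X q).
  move=> fD fZ; have f0 : f 0 = 0 by rewrite -(scale0r 0) fZ mul0r.
  by rewrite /Y (big_morph f fD f0); apply: eq_bigr => q _; exact: fZ.
have rY : 0 < rho Y.
  rewrite (lin _ (@rhoD R m) (@rhoZ R m)); apply: sum_weights_gt0 => // q /aX.
  by case.
split=> //; have g0 : 0 < gamma R - 1 by rewrite gamma_sub1; lra.
suff : 0 < pressure Y / (gamma R - 1) by rewrite pmulr_lgt0// invr_gt0.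
rewrite -pressure_minE//; move: (vel Y) (mag Y) => v b.
have -> : L v b Y = \sum_(q <- r) w q * L v b (X q).
  rewrite [LHS](_ : _ = \sum_(q <- r) w q * (L v b (X q) - 2^-1 * dotv b b)
      + 2^-1 * dotv b b).
    under eq_bigr do rewrite mulrBr.
    by rewrite sumrB -mulr_suml w1 mul1r subrK.
  pose f U := energy U - dotv v (mom U) + 2^-1 * dotv v v * rho U - dotv b (mag U).
  have fD x y : f (x + y) = f x + f y.
    by rewrite /f energyD momD rhoD magD !dotvDr; ring.
  have fZ c x : f (c *: x) = c * f x.
    by rewrite /f energyZ momZ rhoZ magZ !dotvZr; ring.
  have fE U : L v b U = f U + 2^-1 * dotv b b by [].
  rewrite fE (lin f fD fZ); congr (_ + _); apply: eq_bigr => q _.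
  by rewrite fE addrK.
apply: sum_weights_gt0 => // q qr; apply: lt_le_trans (pressure_min _ _ _).
  by rewrite divr_gt0//; case: (aX _ qr).
by case: (aX _ qr).
Qed.

Lemma admissible_segment (a b : state R m) (t : R) :
  admissible a -> admissible b -> 0 <= t <= 1 -> admissible (a + t *: (b - a)).
Proof.
move=> aa ab /andP[t0 t1].
have := @admissible_sum _ [:: false; true] (fun q => if q then t else 1 - t)
  (fun q => if q then b else a).
rewrite !big_cons !big_nil !addr0 subrK.
have -> : (1 - t) *: a + t *: b = a + t *: (b - a).
  by rewrite scalerBl scale1r scalerBr -addrA [- _ + _]addrC.
by apply=> // -[] // _; rewrite subr_ge0.
Qed.

(** For distinct states the difference of the two sides is the Bregman divergence, already shown
    positive as the denominator of the speeds. *)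
Lemma entropy_gradient_ineq (a b : state R m) : admissible a -> admissible b ->
  entropy a + dentropy a (b - a) <= entropy b.
Proof.
move=> aa ab; have [<-|nab] := eqVneq a b.
  by rewrite subrr -(scale0r 0) dentropyZ mul0r addr0.
have seg t : 0 <= t <= 1 -> admissible (a + t *: (b - a)) by exact: admissible_segment.
have d0 : b - a != 0 by rewrite subr_eq0 eq_sym.
have := ES_hess_gt0 seg d0; rewrite ES_hessE// (addrC a) subrK -addrA -opprD subr_gt0.
exact: ltW.
Qed.

(** Average the tangent inequalities at the mean [Y]; the linear terms cancel because the weights
    sum to 1. *)
Lemma entropy_jensen (I : eqType) (r : seq I) (w : I -> R) (X : I -> state R m) :
  {in r, forall q, 0 <= w q} -> \sum_(q <- r) w q = 1 ->
  {in r, forall q, admissible (X q)} ->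
  entropy (\sum_(q <- r) w q *: X q) <= \sum_(q <- r) w q * entropy (X q).
Proof.
move=> w0 w1 aX; have aY := admissible_sum w0 w1 aX; set Y := \sum_(q <- r) _ in aY *.
have D0 : dentropy Y 0 = 0 by rewrite -(scale0r 0) dentropyZ mul0r.
have -> : entropy Y = \sum_(q <- r) w q * (entropy Y + dentropy Y (X q - Y)).
  under eq_bigr do rewrite mulrDr; rewrite big_split /= -mulr_suml w1 mul1r.
  under [X in _ + X]eq_bigr do rewrite -dentropyZ.
  rewrite -(big_morph _ (dentropyD Y) D0).
  under eq_bigr do rewrite scalerBr.
  by rewrite sumrB -scaler_suml w1 scale1r -/Y subrr D0 addr0.
rewrite big_seq [leRHS]big_seq; apply: ler_sum => q qr.
by apply: ler_wpM2l; [exact: w0|apply: entropy_gradient_ineq => //; exact: aX].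
Qed.

End AdmissibleConvex.

(** * Entropy dissipation at a single interface *)

Section InterfaceDissipation.
Variables (R : realType) (m : nat).
Implicit Types (a b c : state R m) (Phi : R -> state R m).

Lemma SR_ge0 a b Phi : 0 <= SR a b Phi.
Proof.
have h : 0 <= SR_std a b by rewrite /SR_std le_max lexx orbT.
by rewrite /SR; case: ifP => // _; rewrite le_max h.
Qed.

Lemma SL_le0 a b Phi : SL a b Phi <= 0.
Proof.
have h : SL_std a b <= 0 by rewrite /SL_std ge_min lexx orbT.
by rewrite /SL; case: ifP => // _; rewrite ge_min h.
Qed.

Lemma SR_ES_le a b Phi : a != b -> SR_ES a b Phi <= SR a b Phi.
Proof. by move=> ab; rewrite /SR (negbTE ab) le_max lexx orbT. Qed.

Lemma SL_ES_ge a b Phi : a != b -> SL a b Phi <= SL_ES a b Phi.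
Proof. by move=> ab; rewrite /SL (negbTE ab) ge_min lexx orbT. Qed.

(** For distinct states this is the inequality [SR_ES <= SR] multiplied by its positive denominator.
    For equal states no such condition is imposed and both sides are 0, provided the path integral
    vanishes. *)
Lemma SR_bound a b Phi : admissible a -> admissible b ->
  (a = b -> path_integral Phi = 0) ->
  entropy_flux b - entropy_flux a - dentropy a (flux b - flux a)
    - dentropy a (path_integral Phi)
  <= SR a b Phi * (entropy b - entropy a - dentropy a (b - a)).
Proof.
move=> aa ab J0; have [e|nab] := eqVneq a b.
  have D0 : dentropy a 0 = 0 by rewrite -(scale0r 0) dentropyZ mul0r.
  by rewrite (J0 e) -e !subrr D0 !subr0 mulr0.
have seg t : 0 <= t <= 1 -> admissible (a + t *: (b - a)) by exact: admissible_segment.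
have d0 : b - a != 0 by rewrite subr_eq0 eq_sym.
have H := ES_hess_gt0 seg d0.
have E := ES_hessE seg; have N := ES_numeratorE seg; rewrite (addrC a) subrK in E N.
rewrite -E -ler_pdivrMr// -N -gradE//.
exact: SR_ES_le.
Qed.

Lemma SL_bound a b Phi : admissible a -> admissible b ->
  (a = b -> path_integral Phi = 0) ->
  SL a b Phi * (entropy a - entropy b - dentropy b (a - b)) <=
  entropy_flux a - entropy_flux b - dentropy b (flux a - flux b)
    + dentropy b (path_integral Phi).
Proof.
move=> aa ab J0; have [e|nab] := eqVneq a b.
  have D0 : dentropy b 0 = 0 by rewrite -(scale0r 0) dentropyZ mul0r.
  by rewrite (J0 e) e !subrr D0 !subr0 addr0 mulr0.
have seg t : 0 <= t <= 1 -> admissible (b + t *: (a - b)) by exact: admissible_segment.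
have d0 : a - b != 0 by rewrite subr_eq0.
have H := ES_hess_gt0 seg d0.
have E := ES_hessE seg; have N := ES_numeratorE seg; rewrite (addrC b) subrK in E N.
rewrite -E -ler_pdivlMr// -N -gradE//.
exact: SL_ES_ge.
Qed.

(** [T1] is the nonnegative fraction [- SL / (SR - SL)] times the defect in [SR_bound]. *)
Lemma T1_le0 b c Phi : admissible b -> admissible c ->
  SL b c Phi < SR b c Phi -> (b = c -> path_integral Phi = 0) -> T1 b c Phi <= 0.
Proof.
move=> ab ac SLR J0; have B := SR_bound ab ac J0.
have sl := SL_le0 b c Phi.
rewrite /T1 gradE// /num_entropy_flux /num_flux /fluct_m.
move: (SL _ _ _) (SR _ _ _) SLR B sl => l r lr B l0.
have rl : r - l != 0 by rewrite subr_eq0 gt_eqF.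
rewrite !(dentropyD, dentropyN, dentropyZ).
rewrite [leLHS](_ : _ = - l / (r - l) * ((entropy_flux c - entropy_flux b
    - dentropy b (flux c - flux b) - dentropy b (path_integral Phi))
    - r * (entropy c - entropy b - dentropy b (c - b)))).
  by rewrite mulr_ge0_le0 ?divr_ge0 ?oppr_ge0 ?subr_ge0 ?(ltW lr)// subr_le0.
rewrite !(dentropyD, dentropyN).
move: (entropy_flux b) (entropy_flux c) (entropy b) (entropy c) (dentropy b (flux b))
  (dentropy b (flux c)) (dentropy b b) (dentropy b c) (dentropy b (path_integral Phi))
  => x1 x2 x3 x4 x5 x6 x7 x8 x9.
by clear B; field.
Qed.

(** [T2] is the nonnegative fraction [SR / (SR - SL)] times the defect in [SL_bound]. *)
Lemma T2_ge0 a b Phi : admissible a -> admissible b ->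
  SL a b Phi < SR a b Phi -> (a = b -> path_integral Phi = 0) -> 0 <= T2 a b Phi.
Proof.
move=> aa ab SLR J0; have B := SL_bound aa ab J0.
have sr := SR_ge0 a b Phi.
rewrite /T2 gradE// /num_entropy_flux /num_flux /fluct_p.
move: (SL _ _ _) (SR _ _ _) SLR B sr => l r lr B r0.
have rl : r - l != 0 by rewrite subr_eq0 gt_eqF.
rewrite !(dentropyD, dentropyN, dentropyZ).
rewrite [leRHS](_ : _ = r / (r - l) * ((entropy_flux a - entropy_flux b
    - dentropy b (flux a - flux b) + dentropy b (path_integral Phi))
    - l * (entropy a - entropy b - dentropy b (a - b)))).
  by rewrite mulr_ge0 ?divr_ge0 ?subr_ge0 ?(ltW lr).
rewrite !(dentropyD, dentropyN).
move: (entropy_flux b) (entropy_flux a) (entropy b) (entropy a) (dentropy b (flux b))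
  (dentropy b (flux a)) (dentropy b b) (dentropy b a) (dentropy b (path_integral Phi))
  => x1 x2 x3 x4 x5 x6 x7 x8 x9.
by clear B; field.
Qed.

End InterfaceDissipation.

(** * The three-point scheme *)

Section Rayleigh.
Variables (R : realType) (n : nat) (H : 'M[R]_n).
Hypothesis symH : H^T = H.
Implicit Types (u v : 'rV[R]_n).


(** Row vectors are used because [eigenvalue] refers to left eigenvectors, [v *m H = r *: v]. *)
Let q u v : R := (u *m H *m v^T) 0 0.

Let s u v : R := (u *m v^T) 0 0.


Let sE u v : s u v = \sum_i u 0 i * v 0 i.
Proof. by rewrite /s mxE; apply: eq_bigr => i _; rewrite mxE. Qed.


Let qE u v : q u v = s (u *m H) v. Proof. by []. Qed.


Let sC u v : s u v = s v u.
Proof. by rewrite !sE; apply: eq_bigr => i _; rewrite mulrC. Qed.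


Let qC u v : q u v = q v u.
Proof. by rewrite qE sC /s /q trmx_mul symH mulmxA. Qed.


Let sD u v w : s (u + v) w = s u w + s v w.
Proof. by rewrite /s mulmxDl mxE. Qed.


Let sZ c u w : s (c *: u) w = c * s u w.
Proof. by rewrite /s -scalemxAl mxE. Qed.


Let sB u v w : s (u - v) w = s u w - s v w.
Proof. by rewrite sD -scaleN1r sZ mulN1r. Qed.

Let qD u v w : q (u + v) w = q u w + q v w.
Proof. by rewrite !qE mulmxDl sD. Qed.


Let qZ c u w : q (c *: u) w = c * q u w.
Proof. by rewrite !qE -scalemxAl sZ. Qed.


Let s_ge0 u : 0 <= s u u.
Proof. by rewrite sE; apply: sumr_ge0 => i _; rewrite -expr2 sqr_ge0. Qed.


Let s_eq0 u : s u u = 0 -> u = 0.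
Proof.
move=> u0; have : dotv u^T u^T == 0.
  by rewrite -u0 sE; apply/eqP/eq_bigr => i _; rewrite !mxE.
by rewrite dotvv_eq0 => /eqP uT; rewrite -[u]trmxK uT trmx0.
Qed.


Let cont_coord i u : {for u, continuous (fun v : 'rV[R]_n => v 0 i)}.
Proof. exact: coord_continuous. Qed.

Let cont_s : continuous (fun u => s u u).
Proof.
rewrite (_ : (fun u => _) = fun u => \sum_i u 0 i * u 0 i).
  by move=> u; apply: cont_sum => i; exact: (cont_mul (@cont_coord i u) (@cont_coord i u)).
by apply/funext => u; rewrite sE.
Qed.


Let cont_q : continuous (fun u => q u u).
Proof.
rewrite (_ : (fun u => _) = fun u => \sum_i (\sum_j u 0 j * H j i) * u 0 i).
  move=> u; apply: cont_sum => i.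
  apply: (cont_mul (cont_sum _) (@cont_coord i u)) => j.
  exact: (cont_mul (@cont_coord j u) (cont_const _ _)).
by apply/funext => u; rewrite qE sE; apply: eq_bigr => i _; rewrite mxE.
Qed.


Let coord_le1 u i : s u u = 1 -> (u 0 i) ^+ 2 <= 1.
Proof.
rewrite sE (bigD1 i)//= => <-; rewrite expr2 lerDl; apply: sumr_ge0 => j _.
by rewrite -expr2 sqr_ge0.
Qed.


(** The form attains its maximum on the compact unit sphere, and homogeneity of degree 2 extends the
    bound to all vectors. The vector [u0] guarantees that the sphere is nonempty, since the
    dimension may be 0. *)
Let maximizer u0 : u0 != 0 ->
  exists2 c, s c c = 1 & forall u, q u u <= q c c * s u u.
Proof.
move=> u00; pose A := [set u | s u u = 1].
have normalize u : u != 0 -> A ((Num.sqrt (s u u))^-1 *: u).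
  move=> un; have sp : 0 < s u u.
    by rewrite lt_neqAle s_ge0 andbT eq_sym; apply: contra un => /eqP/s_eq0 ->.
  rewrite /A /= sZ sC sZ mulrA -invfM -expr2 sqr_sqrtr ?(ltW sp)// mulVf//.
  by rewrite gt_eqF.
have cA : compact A.
  apply: bounded_closed_compact.
    exists 1; split; first exact: num_real.
    move=> M M1 u uA; have M0 : 0 <= M by rewrite (le_trans ler01)// ltW.
    rewrite /= [leLHS]/Num.Def.normr/= mx_normrE (bigmax_le _ M0)//= => -[i j] _ /=.
    rewrite ord1; apply: le_trans (ltW M1).
    by rewrite -(@ler_pXn2r _ 2)// ?nnegrE// expr1n -normrX ger0_norm ?sqr_ge0// coord_le1.
  rewrite (_ : A = (fun u => s u u) @^-1` [set 1]); last by [].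
  apply: closed_comp; first by move=> u _; exact: cont_s.
  exact: closed_eq.
have [||c cA1 cmax] := @compact_EVT_max _ R (fun u => q u u) A _ cA.
- by exists ((Num.sqrt (s u0 u0))^-1 *: u0); exact: normalize.
- by apply: continuous_subspaceT => u; exact: cont_q.
have c1 : s c c = 1 by move: cA1; rewrite inE.
exists c => // u; have [->|un] := eqVneq u 0.
  by rewrite -(scale0r 0) qZ sZ !mul0r mulr0.
have sp : 0 < s u u.
  by rewrite lt_neqAle s_ge0 andbT eq_sym; apply: contra un => /eqP/s_eq0 ->.
have := cmax _ (mem_set (normalize _ un)).
rewrite qZ qC qZ mulrA -invfM -expr2 sqr_sqrtr ?(ltW sp)//.
by rewrite mulrC ler_pdivrMr.
Qed.

(* First variation at a maximizer [c] of the Rayleigh quotient, in the direction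
   [w] of the eigenvector defect. *)

Let maximizer_eigen c : s c c = 1 -> (forall u, q u u <= q c c * s u u) ->
  c *m H = q c c *: c.
Proof.
move=> c1 cmax; set M := q c c in cmax *.
pose w := c *m H - M *: c; suff : s w w = 0.
  by move=> /s_eq0/eqP; rewrite subr_eq0 => /eqP.
have lin : q c w - M * s c w = s w w.
  by rewrite [in RHS]/w sB sZ.
clearbody w; set K := M * s w w - q w w.
have K0 : 0 <= K by rewrite subr_ge0.
have var t : 2 * t * s w w <= t ^+ 2 * K.
  have := cmax (c + t *: w).
  rewrite qD qZ (qC c) (qC w (c + _)) !qD !qZ (qC w c) -/M.
  rewrite sD sZ (sC c) (sC w (c + _)) !sD !sZ (sC w c) c1.
  have : t * (q c w - M * s c w) = t * s w w by rewrite lin.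
  by rewrite /K; lra.
(* The variation reads [2 t x <= t ^ 2 K] with [x = s w w]. At [t = x / (K + 1)], where the 1 guards
   against [K = 0], it forces [x ^ 2 <= 0]. *)
move: (s w w) K K0 (s_ge0 w) var => x {}K K0 x0 /(_ (x / (K + 1))) var.
have e0 : 0 < (K + 1)^-1 by rewrite invr_gt0 ltr_wpDl.
have eK : (K + 1)^-1 * K <= 1 by rewrite mulrC ler_pdivrMr ?ltr_wpDl// mul1r lerDl.
have ex : (K + 1)^-1 * K * ((K + 1)^-1 * x ^+ 2) <= (K + 1)^-1 * x ^+ 2.
  by rewrite ler_piMl// mulr_ge0 ?sqr_ge0// ltW.
have : (K + 1)^-1 * x ^+ 2 <= 0 by move: (K + 1)^-1 var ex => e; lra.
rewrite pmulr_rle0// => x2; apply/eqP; rewrite -sqrf_eq0.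
by apply/eqP/le_anti; rewrite x2 sqr_ge0.
Qed.

Let sigma_maxE c : s c c = 1 -> (forall u, q u u <= q c c * s u u) ->
  sigma_max H = q c c.
Proof.
move=> c1 cmax; have c0 : c != 0.
  by apply: contra_eq_neq c1 => ->; rewrite -(scale0r 0) sZ mul0r eq_sym oner_eq0.
have bnd r : eigenvalue H r -> r <= q c c.
  move=> /eigenvalueP[v vH v0]; have sp : 0 < s v v.
    by rewrite lt_neqAle s_ge0 andbT eq_sym; apply: contra v0 => /eqP/s_eq0 ->.
  by rewrite -(ler_pM2r sp); apply: le_trans (cmax v); rewrite qE vH sZ.
have ev : eigenvalue H (q c c).
  by apply/eigenvalueP; exists c => //; exact: maximizer_eigen.
apply: le_anti; apply/andP; split.
  by apply: ge_sup; [exists (q c c)|move=> r /bnd].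
by apply: ub_le_sup => //; exists (q c c) => r /bnd.
Qed.

Lemma rayleigh_le_sigma_max (x : 'cV[R]_n) :
  (x^T *m H *m x) 0 0 <= sigma_max H * dotv x x.
Proof.
have [->|x0] := eqVneq x 0.
  by rewrite mulmx0 mxE (_ : dotv _ _ = 0) ?mulr0//; apply/eqP; rewrite dotvv_eq0.
have xT0 : x^T != 0 by apply: contra x0 => /eqP h; rewrite -[x]trmxK h trmx0.
have [c c1 cmax] := maximizer xT0; rewrite (sigma_maxE c1 cmax).
by have := cmax x^T; rewrite /q /s trmxK dotv_mx.
Qed.

(** A crude bound, but continuous in the entries, meant to control [sigma_max] uniformly along a
    segment. It holds termwise by [2 y z h <= (y z) ^ 2 + h ^ 2] with unit-vector coordinates [y]
    and [z]. *)
Lemma sigma_max_le (x : 'cV[R]_n) : x != 0 ->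
  sigma_max H <= \sum_i \sum_j (1 + H i j * H i j).
Proof.
move=> x0; have xT0 : x^T != 0 by apply: contra x0 => /eqP h; rewrite -[x]trmxK h trmx0.
have [c c1 cmax] := maximizer xT0; rewrite (sigma_maxE c1 cmax) qE sE exchange_big /=.
apply: ler_sum => i _; rewrite mxE mulr_suml; apply: ler_sum => j _.
have := coord_le1 j c1; have := coord_le1 i c1.
move: (c 0 j) (c 0 i) (H j i) => y z h z1 y1.
have yz : (y * z) ^+ 2 <= 1 by rewrite exprMn mulr_ile1 ?sqr_ge0.
have := sqr_ge0 (y * z - h); have := sqr_ge0 h; lra.
Qed.

End Rayleigh.

(** * From the CFL condition to the three-point entropy inequality *)

Section ThreePoint.
Variables (R : realType) (m : nat).
Implicit Types (a b c : state R m) (Phi : R -> state R m).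

(** [sup] dominates its set only when the set is bounded above. The bound is the maximum over
    [[0, 1]] of the continuous entrywise majorant of [sigma_max]. *)
Lemma max_hess_ge a b (t : R) : admissible a -> admissible b -> a != b ->
  0 <= t <= 1 -> sigma_max (hess (@entropy R m) (a + t *: (b - a))) <= max_hess a b.
Proof.
move=> aa ab nab t01; apply: ub_le_sup; last first.
  by exists t => //=; rewrite in_itv.
have seg z : 0 <= z <= 1 -> admissible (a + z *: (b - a)) by exact: admissible_segment.
pose L (z : R) := \sum_i \sum_j (1 + d2entropy (a + z *: (b - a)) (delta_mx j 0) (delta_mx i 0)
  * d2entropy (a + z *: (b - a)) (delta_mx j 0) (delta_mx i 0)).
have cL (z : R) : 0 <= z <= 1 -> {for z, continuous L}.
  move=> z01; have cd (i j : 'I_(sdim m)) : {for z, continuous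
     (fun y : R => d2entropy (a + y *: (b - a)) (delta_mx j 0) (delta_mx i 0))}.
    apply: cont_d2entropy; last exact: seg.
    by move=> k; exact: line_continuous (is_derive_coord _ _ _).
  apply: cont_sum => i; apply: cont_sum => j.
  by apply: cont_add; [exact: cont_const|apply: cont_mul; exact: cd].
have [z0 _ zmax] := EVT_max ler01 (continuous_itv cL).
exists (L z0) => s /= [z]; rewrite in_itv/= => z01 <-.
apply: le_trans (zmax z _); last by rewrite in_itv.
have ba : b - a != 0 by rewrite subr_eq0 eq_sym.
apply: le_trans (sigma_max_le (hess_sym (seg z z01)) ba) _.
by apply: ler_sum => i _; apply: ler_sum => j _; rewrite !hess_entry//; exact: seg.
Qed.

(** The values of flux and entropy flux at [b] cancel, and the fluctuations complete the flux
    difference to [T3]. This ties the dissipation to the first-order term of the Taylor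
    expansion. *)
Lemma T1_sub_T2 a b c Phi1 Phi2 : admissible b ->
  T1 b c Phi2 - T2 a b Phi1 = num_entropy_flux b c Phi2 - num_entropy_flux a b Phi1
    - dentropy b (T3 a b c Phi1 Phi2).
Proof.
move=> ab; rewrite /T1 /T2 /T3 !gradE//.
move: (num_flux b c Phi2) (num_flux a b Phi1) (fluct_m b c Phi2) (fluct_p a b Phi1)
  (num_entropy_flux b c Phi2) (num_entropy_flux a b Phi1) (flux b) (entropy_flux b)
  => f g p q x y fb e.
rewrite !(dentropyD, dentropyN).
move: (dentropy b f) (dentropy b g) (dentropy b p) (dentropy b q) (dentropy b fb).
by move=> {}f {}g {}p {}q {}fb; ring.
Qed.

(** Under the CFL condition the Taylor remainder [mu ^ 2 * M * |T3| ^ 2 / 2] is at most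
    [mu * (T2 - T1)]; by [T1_sub_T2] this turns the linear term into the difference of entropy
    fluxes. *)
Lemma three_point_entropy a b c Phi1 Phi2 (mu : R) :
  admissible a -> admissible b -> admissible c ->
  SL a b Phi1 < SR a b Phi1 -> SL b c Phi2 < SR b c Phi2 ->
  (a = b -> path_integral Phi1 = 0) -> (b = c -> path_integral Phi2 = 0) ->
  0 <= mu -> cfl a b c Phi1 Phi2 mu ->
  entropy (three_point a b c Phi1 Phi2 mu) <= entropy b
    - mu * (num_entropy_flux b c Phi2 - num_entropy_flux a b Phi1).
Proof.
move=> aa ab ac lr1 lr2 J1 J2 mu0; rewrite /cfl /=.
have E := T1_sub_T2 a c Phi1 Phi2 ab.
have t1 := T1_le0 ab ac lr2 J2; have t2 := T2_ge0 aa ab lr1 J1.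
clear lr1 lr2 J1 J2.
move: (T1 b c Phi2) (T2 a b Phi1) (num_entropy_flux b c Phi2)
  (num_entropy_flux a b Phi1) E t1 t2 => t1 t2 x y E t1_le0 t2_ge0.
rewrite /three_point; move: (T3 a b c Phi1 Phi2) E => D E [an].
have D0 : dentropy b 0 = 0 by rewrite -(scale0r 0) dentropyZ mul0r.
(* If [D = 0] the state does not move, and the difference of entropy fluxes is [T1 - T2 <= 0]. *)
have [Dz|Dn] := eqVneq D 0.
  move=> _; rewrite Dz scaler0 subr0 lerDl oppr_ge0 mulr_ge0_le0//.
  by move: E; rewrite Dz D0 subr0 => <-; rewrite subr_le0 (le_trans t1_le0).
have [->|mun] := eqVneq mu 0; first by rewrite scale0r mul0r !subr0.
case=> [Dz|]; first by rewrite Dz eqxx in Dn.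
pose d := - (mu *: D).
have d0 : d != 0 by rewrite oppr_eq0 scaler_eq0 negb_or mun.
have nb : b != b + d by rewrite -subr_eq0 opprD addrA subrr sub0r oppr_eq0.
have bd : b + d - b = d by rewrite addrAC subrr add0r.
have seg (t : R) : 0 <= t <= 1 -> admissible (b + t *: d).
  by move=> t01; rewrite -bd; exact: admissible_segment.
rewrite -/d in an *; set M := max_hess _ _ => cond.
have HM (t : R) : 0 <= t <= 1 -> d2entropy (b + t *: d) d d <= M * dotv d d.
  move=> t01; rewrite -hessE; last exact: seg.
  apply: le_trans (rayleigh_le_sigma_max (hess_sym (seg t t01)) d) _.
  rewrite ler_wpM2r ?dotvv_ge0//; have := max_hess_ge ab an nb t01.
  by rewrite bd.
have dd : 0 < dotv d d by rewrite dotvv_gt0.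
(* Strict convexity makes [M] positive, so that its inverse in the CFL condition can be cleared. *)
have M0 : 0 < M.
  have := HM 0; rewrite lexx ler01 => /(_ isT); rewrite -(pmulr_lgt0 _ dd).
  by apply: lt_le_trans; apply: d2entropy_gt0 => //; apply: seg; rewrite lexx ler01.
have taylor := entropy_taylor_le seg HM.
have DD : 0 < dotv D D by rewrite dotvv_gt0.
have dDD : dotv d d = mu ^+ 2 * dotv D D.
  by rewrite /d -scaleNr dotvZl dotvZr; ring.
have Ed : dentropy b d = - (mu * dentropy b D) by rewrite /d dentropyN dentropyZ.
rewrite Ed dDD in taylor.
have c1 : mu * (M * dotv D D) <= 2 * (t2 - t1).
  by move: cond; rewrite ler_pdivlMr// ler_pdivlMr// mulrA.
have c2 : mu * (mu * (M * dotv D D)) <= mu * (2 * (t2 - t1)) by rewrite ler_wpM2l.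
have c3 : mu * (t1 - t2) = mu * (x - y - dentropy b D) by rewrite E.
apply: le_trans taylor _; move: (dotv D D) (dentropy b D) c2 c3 => s g c2 c3.
clear -c2 c3; lra.
Qed.

End ThreePoint.

(** * Gauss-Lobatto quadrature *)

Section PolynomialIntegrals.
Variable R : realType.
Implicit Types (p : {poly R}) (a b : R).

Lemma poly_antiderivative p : exists P : {poly R}, P^`()%R = p.
Proof.
exists (\poly_(i < (size p).+1) (p`_i.-1 / i%:R)); apply/polyP => i.
rewrite coef_deriv coef_poly ltnS; case: ltnP => ip; last first.
  by rewrite mul0rn nth_default.
by rewrite /= -[LHS]mulr_natr divfK// pnatr_eq0.
Qed.

Lemma poly_zero_itv p a b : a < b -> (forall t, a <= t <= b -> p.[t] = 0) -> p = 0.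
Proof.
(* As many distinct zeros as the size of [p]: the points [a + (b - a) / (i + 1)]. *)
move=> ab p0; pose f i := a + (b - a) / i.+1%:R.
apply: (@roots_geq_poly_eq0 _ p (mkseq f (size p))); last by rewrite size_mkseq.
- apply/allP => _ /mapP[i _ ->]; apply/eqP/p0; rewrite /f.
  have i0 : (0 : R) < i.+1%:R by rewrite ltr0n.
  apply/andP; split; first by rewrite lerDl divr_ge0 ?subr_ge0 ?(ltW ab) ?(ltW i0).
  rewrite addrC -lerBrDr ler_pdivrMr// ler_peMr ?subr_ge0 ?(ltW ab)//.
  by rewrite ler1n.
- rewrite map_inj_uniq ?iota_uniq// => i j /addrI h; apply/eqP.
  have ba : b - a != 0 by rewrite subr_eq0 gt_eqF.
  by have /invr_inj/eqP := mulfI ba h; rewrite eqr_nat eqSS.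
Qed.

(** An antiderivative is nondecreasing; equal values at the end points would make it constant on the
    interval, hence constant as a polynomial, and [p = 0]. *)
Lemma Rintegral_poly_gt0 p a b : a < b -> p != 0 ->
  (forall t, a <= t <= b -> 0 <= p.[t]) ->
  0 < \int[lebesgue_measure]_(t in `[a, b]) p.[t].
Proof.
move=> ab p0 p_ge0; have [P dP] := poly_antiderivative p.
have dPt (t : R) : is_derive t 1 (horner P) p.[t] by rewrite -dP; exact: is_derive_poly.
rewrite (Rintegral_antiderivative (ltW ab) (fun t _ => dPt t)); last first.
  by move=> t _; exact: continuous_horner.
have mono s t : a <= s -> s <= t -> t <= b -> P.[s] <= P.[t].
  rewrite le_eqVlt => as_; rewrite le_eqVlt => /predU1P[->//|st] tb.
  have [c /andP[sc ct] E] := is_derive_MVT st (fun t _ => dPt t).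
  rewrite -subr_ge0 E mulr_ge0 ?subr_ge0 ?(ltW st)// p_ge0//.
  apply/andP; split; last exact: le_trans (ltW ct) tb.
  by apply: le_trans (ltW sc); case/predU1P: as_ => [->|/ltW].
rewrite lt_neqAle subr_ge0 mono ?(ltW ab)// andbT eq_sym subr_eq0.
apply: contra p0 => /eqP Pba.
have : P - P.[a]%:P = 0.
  apply: poly_zero_itv ab _ => t /andP[at_ tb]; rewrite hornerD hornerN hornerC.
  apply/eqP; rewrite subr_eq0 eq_le; apply/andP; split; last by rewrite mono.
  by rewrite -[leRHS]Pba mono.
by move/subr0_eq => Pa; rewrite -dP Pa derivC.
Qed.

End PolynomialIntegrals.

(** * Positivity and normalization of the quadrature weights *)

Section GaussLobatto.
Variables (R : realType) (N : nat) (a b : R) (x w : nat -> R).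
Hypothesis GL : gauss_lobatto N a b x w.

Let N2 : (2 <= N)%N. Proof. by case: GL. Qed.
Let x1 : x 1%N = a. Proof. by case: GL. Qed.
Let xN : x N = b. Proof. by case: GL. Qed.

Lemma gauss_lobatto_lt q r : (1 <= q)%N -> (q < r)%N -> (r <= N)%N -> x q < x r.
Proof. by case: GL => _ _ _ + _; exact. Qed.

Lemma gauss_lobatto_itv_lt : a < b.
Proof. by rewrite -x1 -xN gauss_lobatto_lt. Qed.

Lemma gauss_lobatto_bounds q : (1 <= q <= N)%N -> a <= x q <= b.
Proof.
move=> /andP[q1 qN]; apply/andP; split.
- rewrite -x1; move: q1; rewrite leq_eqVlt => /predU1P[<-//|q1].
  by rewrite ltW// gauss_lobatto_lt.
- rewrite -xN; move: qN; rewrite leq_eqVlt => /predU1P[->//|qN].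
  by rewrite ltW// gauss_lobatto_lt.
Qed.

Lemma gauss_lobatto_inj q r : (1 <= q <= N)%N -> (1 <= r <= N)%N ->
  (x q == x r) = (q == r).
Proof.
move=> /andP[q1 qN] /andP[r1 rN]; case: (ltngtP q r) => [qr|rq|->]; last exact: eqxx.
- by rewrite lt_eqF// gauss_lobatto_lt.
- by rewrite gt_eqF// gauss_lobatto_lt.
Qed.

Lemma gauss_lobatto_exact (p : {poly R}) : (size p <= 2 * N - 2)%N ->
  \sum_(1 <= q < N.+1) w q * p.[x q]
  = (b - a)^-1 * \int[lebesgue_measure]_(t in `[a, b]) p.[t].
Proof. by case: GL => _ _ _ _; exact. Qed.

(* A nonnegative polynomial of the exactness degree which vanishes at every node
   but [x q]. *)
Let bump q : {poly R} :=
  let Q := \prod_(r <- [seq r <- iota 2 (N - 2) | r != q]) ('X - (x r)%:P) in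
  (if q == 1%N then 1 else 'X - a%:P) * (if q == N then 1 else b%:P - 'X) * (Q * Q).

(** Degree count: an end node leaves one linear factor and [N - 2] squared ones, exactly [2 N - 3];
    an interior node leaves two linear factors and [N - 3] squared ones, [2 N - 4]. *)
Let size_bump q : (1 <= q <= N)%N -> (size (bump q) <= 2 * N - 2)%N.
Proof.
move=> /andP[q1 qN]; rewrite /bump; set Q := \prod_(r <- _) _.
have sQ : size Q = (size [seq r <- iota 2 (N - 2) | r != q]).+1.
  by rewrite /Q size_prod_XsubC.
have sQQ : (size (Q * Q)%R <= (size Q + size Q).-1)%N := size_polyMleq _ _.
set A := if _ then _ else _; set B := if _ then _ else _.
have sA : (size A <= (q != 1%N).+1)%N.
  by rewrite /A; case: ifP; rewrite ?size_poly1 ?size_XsubC.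
have sB : (size B <= (q != N).+1)%N.
  by rewrite /B; case: ifP; rewrite ?size_poly1// -opprB size_polyN size_XsubC.
have sAB : (size (A * B)%R <= (size A + size B).-1)%N := size_polyMleq _ _.
apply: leq_trans (size_polyMleq _ _) _.
have fl : (size [seq r <- iota 2 (N - 2) | r != q]
    <= N - 2 - ((q != 1%N) && (q != N)))%N.
  have [e|q1n] := eqVneq q 1%N.
    by rewrite /= subn0 size_filter (leq_trans (count_size _ _))// size_iota.
  have [e|qNn] := eqVneq q N.
    by rewrite /= subn0 size_filter (leq_trans (count_size _ _))// size_iota.
  rewrite -rem_filter ?iota_uniq// size_rem ?size_iota; first by lia.
  by rewrite mem_iota; lia.
move: sQQ sAB sA sB fl; rewrite sQ.
move: (size (A * B)%R) (size (Q * Q)%R) (size A) (size B) (size [seq _ <- _ | _]).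
move=> sAB sQQ sA sB f; have [e|q1n] := eqVneq q 1%N.
  have -> : (q != N) by lia.
  rewrite /=; lia.
by have [e|qNn] := eqVneq q N; rewrite /=; lia.
Qed.

Let bump_ge0 q t : a <= t <= b -> 0 <= (bump q).[t].
Proof.
move=> /andP[at_ tb]; rewrite /bump !hornerM -expr2 mulr_ge0 ?sqr_ge0//.
by apply: mulr_ge0; case: ifP => _;
  rewrite ?hornerC ?ler01// hornerD ?hornerN ?hornerX hornerC subr_ge0.
Qed.

Let bump_other q r : (1 <= q <= N)%N -> (1 <= r <= N)%N -> r != q ->
  (bump q).[x r] = 0.
Proof.
move=> hq hr rq; rewrite /bump !hornerM.
have [r1|r1] := eqVneq r 1%N.
  rewrite -r1 eq_sym (negbTE rq) r1 hornerD hornerN hornerX hornerC -x1 subrr.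
  by rewrite !mul0r.
have [rN|rN] := eqVneq r N.
  rewrite -rN (eq_sym q r) (negbTE rq) rN hornerD hornerN hornerX hornerC -xN subrr.
  by rewrite mulr0 mul0r.
rewrite [X in _ * (X * _)](_ : _ = 0) ?mul0r ?mulr0//.
apply/eqP; change (root (\prod_(i <- [seq r <- iota 2 (N - 2) | r != q])
  ('X - (x i)%:P)) (x r)); rewrite -(big_map x xpredT (fun c => 'X - c%:P)).
rewrite root_prod_XsubC; apply: map_f; rewrite mem_filter rq mem_iota.
by move: hr r1 rN; lia.
Qed.

Let bump_node q : (1 <= q <= N)%N -> 0 < (bump q).[x q].
Proof.
move=> hq; rewrite lt_neqAle bump_ge0 ?gauss_lobatto_bounds// andbT eq_sym.
have h1 : (1 <= 1 <= N)%N by lia.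
have hN : (1 <= N <= N)%N by lia.
rewrite /bump !hornerM !mulf_neq0//.
- case: ifPn => q1; first by rewrite hornerC oner_eq0.
  by rewrite hornerD hornerN hornerX hornerC -x1 subr_eq0 gauss_lobatto_inj.
- case: ifPn => qN; first by rewrite hornerC oner_eq0.
  by rewrite hornerD hornerN hornerX hornerC -xN subr_eq0 gauss_lobatto_inj// eq_sym.
- all: rewrite horner_prod prodf_seq_neq0; apply/allP => r.
  all: rewrite mem_filter mem_iota => /andP[rq rI] /=.
  all: by rewrite hornerXsubC subr_eq0 gauss_lobatto_inj 1?eq_sym//; lia.
Qed.

(** The rule is specified by its nodes and exactness alone. On [bump q] it reduces to [w q] times a
    positive value, and it equals the positive mean of a nonzero nonnegative polynomial. *)
Lemma gauss_lobatto_weight_gt0 q : (1 <= q <= N)%N -> 0 < w q.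
Proof.
move=> hq; have E := gauss_lobatto_exact (size_bump hq).
have ab := gauss_lobatto_itv_lt.
have : 0 < \sum_(1 <= r < N.+1) w r * (bump q).[x r].
  rewrite E mulr_gt0 ?invr_gt0 ?subr_gt0//; apply: Rintegral_poly_gt0 => //.
    by apply/eqP => b0; have := bump_node hq; rewrite b0 horner0 ltxx.
  by move=> t; exact: bump_ge0.
have -> : \sum_(1 <= r < N.+1) w r * (bump q).[x r] = w q * (bump q).[x q].
  rewrite (bigD1_seq q) ?iota_uniq//=; last by rewrite mem_index_iota.
  rewrite big_seq_cond big1 ?addr0// => r /andP[]; rewrite mem_index_iota => hr rq.
  by rewrite bump_other// mulr0.
by rewrite pmulr_lgt0// bump_node.
Qed.

Lemma gauss_lobatto_weight_sum : \sum_(1 <= q < N.+1) w q = 1.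
Proof.
have ab := gauss_lobatto_itv_lt.
have sz : (1 <= 2 * N - 2)%N by lia.
have := @gauss_lobatto_exact 1; rewrite size_poly1 => /(_ sz).
under eq_bigr do rewrite hornerC mulr1.
move=> ->; under eq_Rintegral do rewrite hornerC.
have dI (t : R) : a <= t <= b -> is_derive t 1 (fun s : R => s) 1.
  by move=> _; exact: is_derive_id.
have cI (t : R) : a <= t <= b -> {for t, continuous (fun=> 1 : R)}.
  by move=> _; exact: cont_const.
by rewrite (Rintegral_antiderivative (ltW ab) dI cI) mulVf// subr_eq0 gt_eqF.
Qed.

End GaussLobatto.

(** * Path integrals along a cell *)

Section PathIntegrals.
Variables (R : realType) (m : nat).
Implicit Types (c : 'cV[{poly R}]_(sdim m)) (a b : R) (U : state R m).

Lemma cell_evalE c t i : cell_eval c t i 0 = (c i 0).[t].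
Proof. by rewrite mxE. Qed.

Lemma cont_cell_eval c (t : R) i : {for t, continuous (fun s => cell_eval c s i 0)}.
Proof.
have -> : (fun s => cell_eval c s i 0) = horner (c i 0).
  by apply/funext => s; rewrite cell_evalE.
exact: continuous_horner.
Qed.

Definition cell_source c (t : R) : state R m :=
  (deriv (c (iBx m) 0)).[t] *: source (cell_eval c t).

Lemma cell_sourceE c t i :
  cell_source c t i 0 = (deriv (c (iBx m) 0)).[t] * source (cell_eval c t) i 0.
Proof. by rewrite [LHS]mxE. Qed.

Lemma cont_cell_source c t i : admissible (cell_eval c t) ->
  {for t, continuous (fun s => cell_source c s i 0)}.
Proof.
move=> at_; have -> : (fun s => cell_source c s i 0) =
    fun s => (deriv (c (iBx m) 0)).[s] * source (cell_eval c s) i 0.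
  by apply/funext => s; rewrite cell_sourceE.
apply: cont_mul; first exact: continuous_horner.
by apply: cont_source => // j; exact: cont_cell_eval.
Qed.

Lemma derive1_cell_path c a b (s : R) : derive1 (cell_path c a b) s =
  \col_i ((b - a) * (deriv (c i 0)).[a + s * (b - a)]).
Proof.
have d i : is_derive s 1 (fun y : R => cell_path c a b y i 0)
    ((b - a) * (deriv (c i 0)).[a + s * (b - a)]).
  have -> : (fun y : R => cell_path c a b y i 0) =
      horner (c i 0) \o (fun y => a + y * (b - a)).
    by apply/funext => y; rewrite /cell_path cell_evalE.
  have dA : is_derive s 1 (fun y : R => a + y * (b - a)) (b - a).
    have H := is_derive_add (is_derive_const a s 1)
      (is_derive_mul (is_derive_id s 1) (is_derive_const (b - a) s 1)).
    by apply: (is_derive_eq H); rewrite mulr0 addr0 mul1r add0r.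
  have H := is_derive1_comp (g := fun y => a + y * (b - a))
    (is_derive_poly (c i 0) (a + s * (b - a))) dA.
  by apply: (is_derive_eq H); rewrite mulrC.
have D : derivable (cell_path c a b) s 1.
  by apply/derivable_mxP => i j; rewrite (ord1 j); have [] := d i.
rewrite derive1E derive_mx//; apply/matrixP => i j; rewrite (ord1 j) !mxE.
by have [] := d i.
Qed.

(** The factor [b - a] from the chain rule is the Jacobian of the substitution, so the path integral
    of a reparametrized piece is the volume source over that piece. *)
Lemma path_integral_cell_path c a b : a < b ->
  (forall t, a <= t <= b -> admissible (cell_eval c t)) ->
  path_integral (cell_path c a b) = vintegral a b (cell_source c).
Proof.
move=> ab adm; apply/colP => i; rewrite !mxE.
rewrite -(Rintegral_affine ab); last by move=> t /adm at_; exact: cont_cell_source.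
apply: eq_Rintegral => s _.
have dB : (dBx R m *m derive1 (cell_path c a b) s) 0 0 =
    (b - a) * (deriv (c (iBx m) 0)).[a + s * (b - a)].
  by rewrite derive1_cell_path -rowE !mxE.
by rewrite -mulmxA [LHS]mxE big_ord1 dB cell_sourceE /cell_path mulrC mulrA.
Qed.

Lemma vintegral_split c a b e : a <= e -> e <= b ->
  (forall t, a <= t <= b -> admissible (cell_eval c t)) ->
  vintegral a b (cell_source c) =
  vintegral a e (cell_source c) + vintegral e b (cell_source c).
Proof.
move=> ae eb adm; apply/colP => i; rewrite !mxE; apply: Rintegral_split => //.
by move=> t /adm at_; exact: cont_cell_source.
Qed.

(** Only the values on [[0, 1]] are known, and the derivative at the end points depends on values
    outside; the integral is therefore taken over the open interval. *)
Lemma path_integral_const (Phi : R -> state R m) U :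
  (forall xi : R, 0 <= xi <= 1 -> Phi xi = U) -> path_integral Phi = 0.
Proof.
move=> PhiU; apply/colP => i; rewrite !mxE.
have z (s : R) : s \in `]0, 1[%classic ->
    (source (Phi s) *m dBx R m *m derive1 Phi s) i 0 = 0.
  move=> /set_mem/=; rewrite in_itv/= => s01.
  suff -> : derive1 Phi s = 0 by rewrite mulmx0 mxE.
  rewrite derive1E (near_eq_derive (g := cst U)) ?derive_cst//.
  near=> y; apply: PhiU; suff : y \in `]0, 1[ by rewrite in_itv/= => /andP[/ltW -> /ltW ->].
  near: y; exact: near_in_itvoo.
rewrite /Rintegral (@integral_itv_bndoo _ 0 1 _ true false).
  rewrite (eq_integral (fun=> 0%E)) ?integral0// => s s01.
  by rewrite z.
(* Measurability on the open interval: the integrand is 0 there, so a preimage is the whole interval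
   or empty. *)
move=> mI Y _; have [Y0|Y0] := pselect (Y 0%E).
- rewrite (_ : _ `&` _ = `]0, 1[%classic)//; apply/seteqP; split=> s /=; first by case.
  by move=> s01; split=> //; rewrite z// inE.
- rewrite (_ : _ `&` _ = set0)//; apply/seteqP; split=> s //= -[s01].
  by rewrite z ?inE.
Unshelve. all: by end_near. Qed.

End PathIntegrals.

(** * Assembly over a cell *)

Lemma sum_single (V : nmodType) (N i : nat) (A : V) : (1 <= i <= N)%N ->
  \sum_(1 <= q < N.+1) (if q == i then A else 0) = A.
Proof.
move=> hi; rewrite (bigD1_seq i) ?iota_uniq ?mem_index_iota//= eqxx.
by rewrite big1 ?addr0// => q /negbTE ->.
Qed.

Section InterfaceFluxes.
Variables (R : realType) (m : nat).
Implicit Types (a b : state R m) (Phi : R -> state R m).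

(** The fractions [- SL / (SR - SL)] and [SR / (SR - SL)] sum to 1, so splitting the path integral
    between the two sides loses nothing. *)
Lemma fluct_sum a b Phi : SL a b Phi < SR a b Phi ->
  fluct_m a b Phi + fluct_p a b Phi = path_integral Phi.
Proof.
rewrite /fluct_m /fluct_p -scalerDl.
move: (SL a b Phi) (SR a b Phi) => l r lr.
by rewrite -mulrDl addrC divff ?scale1r// subr_eq0 gt_eqF.
Qed.

Lemma num_flux_same a Phi : SL a a Phi < SR a a Phi -> num_flux a a Phi = flux a.
Proof.
rewrite /num_flux subrr scaler0 addr0 -scalerBl scalerA.
move: (SL a a Phi) (SR a a Phi) => l r lr.
by rewrite mulVf ?scale1r// subr_eq0 gt_eqF.
Qed.

Lemma num_entropy_flux_same a Phi : SL a a Phi < SR a a Phi ->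
  num_entropy_flux a a Phi = entropy_flux a.
Proof.
rewrite /num_entropy_flux subrr mulr0 addr0 -mulrBl.
move: (SL a a Phi) (SR a a Phi) => l r lr.
by rewrite mulrAC divff ?mul1r// subr_eq0 gt_eqF.
Qed.

Lemma T3_telescope a b c d (Phi1 Phi2 Phi3 : R -> state R m) :
  SL b c Phi2 < SR b c Phi2 ->
  T3 a b c Phi1 Phi2 + T3 b c d Phi2 Phi3 = num_flux c d Phi3 - num_flux a b Phi1
    + (fluct_m c d Phi3 + fluct_p a b Phi1) + path_integral Phi2.
Proof.
move=> /fluct_sum <-; rewrite /T3.
move: (num_flux b c Phi2) (num_flux c d Phi3) (num_flux a b Phi1) (fluct_m b c Phi2)
  (fluct_m c d Phi3) (fluct_p a b Phi1) (fluct_p b c Phi2) => f1 f2 f3 g1 g2 g3 g4.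
by apply/colP => l; rewrite !mxE; ring.
Qed.

Lemma T3_telescope2 a b c d e (Phi1 Phi2 Phi3 Phi4 : R -> state R m) :
  SL b c Phi2 < SR b c Phi2 -> SL c d Phi3 < SR c d Phi3 ->
  T3 a b c Phi1 Phi2 + T3 b c d Phi2 Phi3 + T3 c d e Phi3 Phi4 =
    num_flux d e Phi4 - num_flux a b Phi1 + (fluct_m d e Phi4 + fluct_p a b Phi1)
    + (path_integral Phi2 + path_integral Phi3).
Proof.
move=> lr1 lr2; rewrite (T3_telescope _ _ _ _ lr1) -(fluct_sum lr2) /T3.
move: (num_flux c d Phi3) (num_flux d e Phi4) (num_flux a b Phi1) (fluct_m c d Phi3)
  (fluct_m d e Phi4) (fluct_p a b Phi1) (fluct_p c d Phi3) (path_integral Phi2).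
by move=> f1 f2 f3 g1 g2 g3 g4 J; apply/colP => l; rewrite !mxE; ring.
Qed.

End InterfaceFluxes.

(** * The updated cell average as a convex combination of nodal updates *)

Section CellUpdate.
Variables (R : realType) (m : nat) (Psi : R -> state R m -> state R m -> state R m).
Variables (x : int -> R) (k : nat) (U : dgfun R m) (i : int) (N : nat).
Variables (xhat w : nat -> R) (lambda : R).
Hypothesis hU : dg_function k x U.
Hypothesis hN : (k.+1 <= N)%N.
Hypothesis GL : gauss_lobatto N (x (i - 1)) (x i) xhat w.

Let Uq q := cell_eval (U i) (xhat q).
Let Fhat j := num_flux (trace_m x U j) (trace_p x U j) (iface_path Psi x U j).
Let Ehat j := num_entropy_flux (trace_m x U j) (trace_p x U j) (iface_path Psi x U j).
Let Dm j := fluct_m (trace_m x U j) (trace_p x U j) (iface_path Psi x U j).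
Let Dp j := fluct_p (trace_m x U j) (trace_p x U j) (iface_path Psi x U j).

Lemma node_admissible q : (1 <= q <= N)%N -> admissible (Uq q).
Proof. by move=> hq; apply: hU.2; exact: gauss_lobatto_bounds GL _ hq. Qed.

(** Each component has size at most [k + 1 <= N], and [N <= 2 N - 2] since [N >= 2], so the
    quadrature is exact. *)
Lemma cell_average_nodes :
  cell_average x U i = \sum_(1 <= q < N.+1) w q *: Uq q.
Proof.
apply/colP => l; rewrite /cell_average mxE /vintegral mxE.
under eq_Rintegral do rewrite cell_evalE.
rewrite -(gauss_lobatto_exact GL); last first.
  apply: leq_trans (hU.1 i l) _; apply: leq_trans hN _.
  by case: GL => N2 _ _ _ _; lia.
rewrite summxE; apply: eq_bigr => q _.
by rewrite [RHS]mxE cell_evalE.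
Qed.

(** The common frame of all cases, which differ only in the corrections [T] and entropy flux
    differences [e] placed at the nodes. Node [q] advances by [lambda / w q], and its weight in the
    convex combination restores [lambda]. *)
Lemma weak_cell_entropy_of_steps (T : nat -> state R m) (e : nat -> R) :
  (forall q, (1 <= q <= N)%N -> admissible (Uq q - (lambda / w q) *: T q) /\
     entropy (Uq q - (lambda / w q) *: T q) <= entropy (Uq q) - lambda / w q * e q) ->
  \sum_(1 <= q < N.+1) T q = Fhat i - Fhat (i - 1) + (Dm i + Dp (i - 1))
    + vintegral (x (i - 1)) (x i) (cell_source (U i)) ->
  \sum_(1 <= q < N.+1) e q = Ehat i - Ehat (i - 1) ->
  weak_cell_entropy Psi x U lambda i N xhat w.
Proof.
move=> step sumT sume.
have w0 q : q \in index_iota 1 N.+1 -> 0 < w q.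
  by rewrite mem_index_iota; exact: (gauss_lobatto_weight_gt0 GL).
rewrite /weak_cell_entropy -/(Ehat i) -/(Ehat (i - 1)).
have -> : dg_update Psi x U lambda i =
    \sum_(1 <= q < N.+1) w q *: (Uq q - (lambda / w q) *: T q).
  have lin (A f d s : state R m) : A - lambda *: f - lambda *: d - lambda *: s
      = A - lambda *: (f + d + s) by rewrite !scalerDr !opprD !addrA.
  transitivity (cell_average x U i - lambda *: \sum_(1 <= q < N.+1) T q).
    by rewrite sumT -lin.
  rewrite cell_average_nodes.
  under [RHS]eq_bigr do rewrite scalerBr scalerA.
  rewrite sumrB; congr (_ - _); rewrite scaler_sumr big_seq [RHS]big_seq.
  by apply: eq_bigr => q /w0 wq; rewrite mulrC divfK// gt_eqF.
apply: le_trans (entropy_jensen _ (gauss_lobatto_weight_sum GL) _) _.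
- by move=> q /w0/ltW.
- by move=> q; rewrite mem_index_iota => /step[].
have -> : \sum_(1 <= q < N.+1) w q * entropy (Uq q) - lambda * (Ehat i - Ehat (i - 1))
    = \sum_(1 <= q < N.+1) w q * (entropy (Uq q) - lambda / w q * e q).
  rewrite -sume mulr_sumr -sumrB big_seq [RHS]big_seq; apply: eq_bigr => q /w0 wq.
  by rewrite mulrBr; congr (_ - _); rewrite !mulrA (mulrC (w q)) mulfK// gt_eqF.
rewrite big_seq [leRHS]big_seq; apply: ler_sum => q qr; rewrite ler_pM2l ?w0//.
by have [] := step q; first by move: qr; rewrite mem_index_iota.
Qed.

(** The difference to the constant has size at most [N] and vanishes at [N] distinct nodes. *)
Lemma constant_cell (Uf : state R m) :
  (forall q, (1 <= q <= N)%N -> Uq q = Uf) -> forall j, U i j 0 = (Uf j 0)%:P.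
Proof.
move=> hUf j; apply/eqP; rewrite -subr_eq0; apply/eqP.
apply: (@roots_geq_poly_eq0 _ _ (map xhat (iota 1 N))).
- apply/allP => y /mapP[q]; rewrite mem_iota add1n ltnS => hq ->.
  apply/eqP; rewrite hornerD hornerN hornerC -cell_evalE -/(Uq q) hUf//.
  by rewrite subrr.
- rewrite map_inj_in_uniq ?iota_uniq// => q r; rewrite !mem_iota !add1n !ltnS.
  by move=> hq hr /eqP; rewrite (gauss_lobatto_inj GL)// => /eqP.
- rewrite size_map size_iota; apply: leq_trans (size_polyD _ _) _.
  rewrite geq_max size_polyN (leq_trans (hU.1 i j))//=.
  by apply: leq_trans (size_polyC_leq1 _) _; lia.
Qed.

Lemma constant_cell_source (Uf : state R m) (a b : R) :
  (forall j, U i j 0 = (Uf j 0)%:P) -> vintegral a b (cell_source (U i)) = 0.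
Proof.
move=> c; apply/colP => l; rewrite !mxE; under eq_Rintegral => t _.
  rewrite cell_sourceE c derivC horner0 mul0r; over.
by rewrite /Rintegral integral0.
Qed.

End CellUpdate.

(** An exterior state equal to [Uf] fits the general three-point argument: [SR] and [SL] then drop
    the entropy-stability speeds by themselves, and the prescribed path is constant with zero path
    integral. *)
Theorem theorem4p1 (R : realType) (m : nat) (hm : (m.+1 <= 3)%N)
    (Psi : R -> state R m -> state R m -> state R m)
    (hPsi : prescribed_path Psi)
    (h : R) (x : int -> R) (hx : mesh h x)
    (k : nat) (U : dgfun R m) (hU : dg_function k x U)
    (dt : R) (hdt : 0 < dt) (i : int)
    (N : nat) (hN : (k.+1 <= N)%N) (xhat w : nat -> R)
    (hGL : gauss_lobatto N (x (i - 1)) (x i) xhat w) :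
  let lambda := dt / h in
  let Ul_m := trace_m x U (i - 1) in
  let Ul_p := trace_p x U (i - 1) in
  let Ur_m := trace_m x U i in
  let Ur_p := trace_p x U i in
  let Psil := iface_path Psi x U (i - 1) in
  let Psir := iface_path Psi x U i in
  let Uq q := cell_eval (U i) (xhat q) in
  let Phi := cell_path (U i) (x (i - 1)) (x i) in
  let PhiL s := cell_path (U i) (x (i - 1)) (xhat s) in
  let PhiR s := cell_path (U i) (xhat s) (x i) in
  let WCE := weak_cell_entropy Psi x U lambda i N xhat w in
  SL Ul_m Ul_p Psil < SR Ul_m Ul_p Psil ->
  SL Ur_m Ur_p Psir < SR Ur_m Ur_p Psir ->
  (Ul_p <> Ur_m ->
     SL Ul_p Ur_m Phi < SR Ul_p Ur_m Phi ->
     cfl Ul_m Ul_p Ur_m Psil Phi (lambda / w 1%N) ->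
     cfl Ul_p Ur_m Ur_p Phi Psir (lambda / w N) ->
     WCE)
  /\
  (forall Uf : state R m, Ul_p = Uf -> Ur_m = Uf ->
     (forall s : nat, (2 <= s <= N.-1)%N -> Uq s <> Uf ->
        SL Ul_p (Uq s) (PhiL s) < SR Ul_p (Uq s) (PhiL s) ->
        SL (Uq s) Ur_m (PhiR s) < SR (Uq s) Ur_m (PhiR s) ->
        cfl Ul_m Ul_p (Uq s) Psil (PhiL s) (lambda / w 1%N) ->
        cfl Ul_p (Uq s) Ur_m (PhiL s) (PhiR s) (lambda / w s) ->
        cfl (Uq s) Ur_m Ur_p (PhiR s) Psir (lambda / w N) ->
        WCE)
     /\
     (~ (exists2 s : nat, (2 <= s <= N.-1)%N & Uq s <> Uf) ->
        [/\ forall t : R, x (i - 1) <= t <= x i -> cell_eval (U i) t = Uf,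
            cfl Ul_m Uf Ur_p Psil Psir lambda -> WCE
          & Ul_m = Uf -> Ur_p = Uf -> WCE])).
Proof.
move=> lambda Ul_m Ul_p Ur_m Ur_p Psil Psir Uq Phi PhiL PhiR WCE lrl lrr.
have [h0 hxm] := hx.
have xs j : x (j - 1) < x j by rewrite -subr_gt0 hxm.
have lam0 : 0 < lambda by rewrite divr_gt0.
have [N2 x1 xN _ _] := hGL.
have h1 : (1 <= 1 <= N)%N by lia.
have hNN : (1 <= N <= N)%N by lia.
have E1 : Ul_p = Uq 1%N by rewrite /Ul_p /trace_p subrK /Uq x1.
have EN : Ur_m = Uq N by rewrite /Ur_m /trace_m /Uq xN.
have al : admissible Ul_m by apply: hU.2; rewrite lexx ltW.
have ar : admissible Ur_p.
  by apply: hU.2; rewrite addrK lexx/=; have := xs (i + 1); rewrite addrK => /ltW.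
have aq q (hq : (1 <= q <= N)%N) : admissible (Uq q) := node_admissible hU hGL hq.
have alp : admissible Ul_p by rewrite E1; exact: aq.
have arm : admissible Ur_m by rewrite EN; exact: aq.
have adm (t : R) : x (i - 1) <= t <= x i -> admissible (cell_eval (U i) t).
  exact: hU.2.
have Jl : Ul_m = Ul_p -> path_integral Psil = 0.
  move=> e; apply: (path_integral_const (U := Ul_m)) => xi h01.
  by rewrite /Psil /iface_path -/Ul_m -/Ul_p -e; exact: hPsi.2.
have Jr : Ur_m = Ur_p -> path_integral Psir = 0.
  move=> e; apply: (path_integral_const (U := Ur_m)) => xi h01.
  by rewrite /Psir /iface_path -/Ur_m -/Ur_p -e; exact: hPsi.2.
have wp q (hq : (1 <= q <= N)%N) : 0 < w q := gauss_lobatto_weight_gt0 hGL hq.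
pose good q (T : state R m) (e : R) := admissible (Uq q - (lambda / w q) *: T) /\
  entropy (Uq q - (lambda / w q) *: T) <= entropy (Uq q) - lambda / w q * e.
(* A node without correction keeps its admissible value, and its step is an equality. *)
have good0 q : (1 <= q <= N)%N -> good q 0 0.
  by move=> hq; rewrite /good scaler0 mulr0 !subr0; split => //; exact: aq.
have good3 q a c Phi1 Phi2 : (1 <= q <= N)%N -> admissible a -> admissible c ->
    SL a (Uq q) Phi1 < SR a (Uq q) Phi1 -> SL (Uq q) c Phi2 < SR (Uq q) c Phi2 ->
    (a = Uq q -> path_integral Phi1 = 0) -> (Uq q = c -> path_integral Phi2 = 0) ->
    cfl a (Uq q) c Phi1 Phi2 (lambda / w q) ->
    good q (T3 a (Uq q) c Phi1 Phi2)
      (num_entropy_flux (Uq q) c Phi2 - num_entropy_flux a (Uq q) Phi1).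
  move=> hq aa ac lr1 lr2 J1 J2 hcfl; split; first exact: hcfl.1.
  apply: three_point_entropy => //; first exact: aq.
  by rewrite ltW// divr_gt0// wp.
have sumE2 (V : nmodType) (A C : V) : \sum_(1 <= q < N.+1)
    ((if q == 1%N then A else 0) + (if q == N then C else 0)) = A + C.
  by rewrite big_split /= !sum_single.
have finish := weak_cell_entropy_of_steps hU hN hGL.
have n1N : (1 == N)%N = false by lia.
split.
- move=> neq lrc cfl1 cflN.
  (* Since [N >= 2] the two corrections sit at different nodes, the end points; all other nodes are
     left unchanged. *)
  pose A := T3 Ul_m Ul_p Ur_m Psil Phi; pose C := T3 Ul_p Ur_m Ur_p Phi Psir.
  pose eA := num_entropy_flux Ul_p Ur_m Phi - num_entropy_flux Ul_m Ul_p Psil.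
  pose eC := num_entropy_flux Ur_m Ur_p Psir - num_entropy_flux Ul_p Ur_m Phi.
  apply: (finish Psi lambda
    (fun q => (if q == 1%N then A else 0) + (if q == N then C else 0))
    (fun q => (if q == 1%N then eA else 0) + (if q == N then eC else 0))).
  + move=> q hq; have [q1|q1] := eqVneq q 1%N.
      rewrite q1 n1N !addr0 /A /eA E1; apply: good3; rewrite -?E1//.
    have [qN|qN] := eqVneq q N; last by rewrite !addr0; exact: good0.
    rewrite qN !add0r /C /eC EN; apply: good3; rewrite -?EN//.
  + rewrite sumE2 /A /C (T3_telescope _ _ _ _ lrc) /Phi.
    by rewrite path_integral_cell_path.
  + by rewrite sumE2 /eA /eC addrC addrA subrK.
- move=> Uf Elf Erf; split.
  + move=> s hs sf lrL lrR cfl1 cfls cflN.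
    have hsN : (1 <= s <= N)%N by clear -hs; lia.
    have xs1 : x (i - 1) < xhat s.
      by rewrite -x1; apply: (gauss_lobatto_lt hGL); clear -hs N2; lia.
    have xsN : xhat s < x i.
      by rewrite -xN; apply: (gauss_lobatto_lt hGL); clear -hs N2; lia.
    (* Both halves of the loop join distinct states, so no vanishing path integral is asked of
       them. *)
    have nl : Ul_p <> Uq s by rewrite Elf => e; exact: sf.
    have nr : Uq s <> Ur_m by rewrite Erf.
    pose A := T3 Ul_m Ul_p (Uq s) Psil (PhiL s).
    pose B := T3 Ul_p (Uq s) Ur_m (PhiL s) (PhiR s).
    pose C := T3 (Uq s) Ur_m Ur_p (PhiR s) Psir.
    pose eA := num_entropy_flux Ul_p (Uq s) (PhiL s) - num_entropy_flux Ul_m Ul_p Psil.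
    pose eB := num_entropy_flux (Uq s) Ur_m (PhiR s)
      - num_entropy_flux Ul_p (Uq s) (PhiL s).
    pose eC := num_entropy_flux Ur_m Ur_p Psir - num_entropy_flux (Uq s) Ur_m (PhiR s).
    have n1s : (1 == s)%N = false by clear -hs N2; lia.
    have nsN : (s == N)%N = false by clear -hs N2; lia.
    have ns1 : (s == 1)%N = false by clear -hs N2; lia.
    have nN1 : (N == 1)%N = false by clear -hs N2; lia.
    have nNs : (N == s)%N = false by clear -hs N2; lia.
    have sumE3 (V : nmodType) (a b c : V) : \sum_(1 <= q < N.+1)
        ((if q == 1%N then a else 0) + (if q == s then b else 0)
         + (if q == N then c else 0)) = a + b + c.
      by rewrite !big_split /= !sum_single.
    apply: (finish Psi lambda
      (fun q => (if q == 1%N then A else 0) + (if q == s then B else 0)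
                + (if q == N then C else 0))
      (fun q => (if q == 1%N then eA else 0) + (if q == s then eB else 0)
                + (if q == N then eC else 0))).
    * move=> q hq; have [->|q1] := eqVneq q 1%N.
        rewrite n1s n1N !addr0 /A /eA E1; apply: good3; rewrite -?E1//.
        exact: aq.
      have [->|qs] := eqVneq q s.
        by rewrite nsN !addr0 !add0r /B /eB; apply: good3.
      have [->|qN] := eqVneq q N; last by rewrite !addr0; exact: good0.
      rewrite !add0r /C /eC EN; apply: good3; rewrite -?EN//.
      exact: aq.
    * have JE : path_integral (PhiL s) + path_integral (PhiR s) =
          vintegral (x (i - 1)) (x i) (cell_source (U i)).
        rewrite (vintegral_split (ltW xs1) (ltW xsN) adm).
        congr (_ + _); apply: path_integral_cell_path => // t /andP[t0 t1]; apply: adm.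
          by rewrite t0 (le_trans t1)// ltW.
        by rewrite (le_trans (ltW xs1)).
      rewrite sumE3 -JE.
      exact: (T3_telescope2 Ul_m Ur_p Psil Psir lrL lrR).
    * rewrite sumE3 /eA /eB /eC.
      move: (num_entropy_flux Ul_p (Uq s) (PhiL s)) (num_entropy_flux Ul_m Ul_p Psil)
        (num_entropy_flux (Uq s) Ur_m (PhiR s)) (num_entropy_flux Ur_m Ur_p Psir).
      by move=> e1 e2 e3 e4; ring.
  + move=> nex.
    have hUf q : (1 <= q <= N)%N -> Uq q = Uf.
      move=> hq; have [->|q1] := eqVneq q 1%N; first by rewrite -E1.
      have [->|qN] := eqVneq q N; first by rewrite -EN.
      have [//|/eqP ne] := eqVneq (Uq q) Uf.
      by case: nex; exists q => //; lia.
    have cst := constant_cell hU hN hGL hUf.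
    have S0 := constant_cell_source (x (i - 1)) (x i) cst.
    split.
    * by move=> t _; apply/colP => j; rewrite cell_evalE cst hornerC.
    * move=> hcfl; pose D := T3 Ul_m Uf Ur_p Psil Psir.
      pose e := num_entropy_flux Uf Ur_p Psir - num_entropy_flux Ul_m Uf Psil.
      (* Here all nodes carry the same state. The correction [w q *: D] cancels the division by
         [w q]: every node makes the same step of size [lambda], which explains the CFL condition
         without a weight. *)
      apply: (finish Psi lambda (fun q => w q *: D) (fun q => w q * e)).
      - move=> q hq; have lw : lambda / w q * w q = lambda by rewrite divfK// gt_eqF// wp.
        rewrite scalerA mulrA lw -/(Uq q) hUf//; split; first exact: hcfl.1.
        have lrl' : SL Ul_m Uf Psil < SR Ul_m Uf Psil by rewrite -Elf.
        have lrr' : SL Uf Ur_p Psir < SR Uf Ur_p Psir by rewrite -Erf.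
        have Jl' : Ul_m = Uf -> path_integral Psil = 0 by rewrite -Elf.
        have Jr' : Uf = Ur_p -> path_integral Psir = 0 by rewrite -Erf.
        have af : admissible Uf by rewrite -Elf.
        exact: (three_point_entropy al af ar lrl' lrr' Jl' Jr' (ltW lam0) hcfl).
      - rewrite -scaler_suml (gauss_lobatto_weight_sum hGL) scale1r S0 addr0.
        rewrite -/Ul_m -/Ul_p -/Ur_m -/Ur_p -/Psil -/Psir Elf Erf addrA.
        reflexivity.
      - rewrite -mulr_suml (gauss_lobatto_weight_sum hGL) mul1r.
        rewrite -/Ul_m -/Ul_p -/Ur_m -/Ur_p -/Psil -/Psir Elf Erf.
        reflexivity.
    (* All states agree: both fluxes are the flux of that state and both fluctuations vanish, so
       every correction is 0 and no CFL condition enters. *)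
    * move=> El Er.
      have fr : fluct_m Ur_m Ur_p Psir = 0.
        by rewrite /fluct_m Jr ?scaler0// Er Erf.
      have fl : fluct_p Ul_m Ul_p Psil = 0.
        by rewrite /fluct_p Jl ?scaler0// El Elf.
      have elr : Ul_p = Ul_m by rewrite El Elf.
      have err : Ur_p = Ur_m by rewrite Er Erf.
      have elm : Ur_m = Ul_m by rewrite El Erf.
      move: lrl lrr; rewrite elr err elm => lrl' lrr'.
      have nl : num_flux Ul_m Ul_p Psil = flux Ul_m by rewrite elr num_flux_same.
      have nr : num_flux Ur_m Ur_p Psir = flux Ul_m by rewrite err elm num_flux_same.
      have el : num_entropy_flux Ul_m Ul_p Psil = entropy_flux Ul_m.
        by rewrite elr num_entropy_flux_same.
      have er : num_entropy_flux Ur_m Ur_p Psir = entropy_flux Ul_m.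
        by rewrite err elm num_entropy_flux_same.
      apply: (finish Psi lambda (fun=> 0) (fun=> 0)) => [q hq||]; first exact: good0.
      - rewrite -/Ul_m -/Ul_p -/Ur_m -/Ur_p -/Psil -/Psir fr fl nl nr S0 subrr !addr0.
        exact: big1.
      - rewrite -/Ul_m -/Ul_p -/Ur_m -/Ur_p -/Psil -/Psir el er subrr.
        exact: big1.
Qed.
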